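(* Let $A_1=C\setminus A_1^\bullet$ and $A_2=C\setminus A_2^\bullet$ be two nonempty $C$-coconvex sets such that $A_1^\bullet,A_2^\bullet\in\mathcal{K}(C,\omega)$, and let $0<p<1$. If the identity of measures $$\overline h(A_1,\cdot)^{1-p}\,\overline S_{n-1}(A_1,\cdot)=\overline h(A_2,\cdot)^{1-p}\,\overline S_{n-1}(A_2,\cdot)$$ holds on $\omega$, then $A_1=A_2$.
   Context: $C\subset\mathbb{R}^n$ is a fixed pointed closed convex cone with vertex at the origin $o$ and nonempty interior (closed, convex, $\lambda x\in C$ for $x\in C$, $\lambda\ge 0$, and $C\cap(-C)=\{o\}$). Its polar cone is $C^\circ=\{x\in\mathbb{R}^n: x\cdot y\le 0\ \text{for all } y\in C\}$, and $\Omega_C=S^{n-1}\cap\mathrm{int}\,C^\circ$. $V_n$ is volume (Lebesgue measure). For $u\in S^{n-1}$, $t\in\mathbb{R}$, $H^-(u,t)=\{x\in\mathbb{R}^n: x\cdot u\le t\}$. A set $A\subset C$ is $C$-coconvex if $V_n(A)<\infty$ and $A^\bullet=C\setminus A$ is closed and convex. For $x\in\mathrm{int}\,C^\circ$, $h(A^\bullet,x)=\sup\{x\cdot y:y\in A^\bullet\}$ and $\overline h(A,x)=-h(A^\bullet,x)$; $\overline h(A,\cdot)$ is positive and finite when $A\neq\emptyset$. Surface area measure: for a Borel set $\eta\subset\Omega_C$, $\overline S_{n-1}(A,\eta)=\mathcal{H}^{n-1}(\nu_{A^\bullet}^{-1}(\eta))$, where $\nu_{A^\bullet}^{-1}(\eta)$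 is the set of points of $\partial A^\bullet\cap\mathrm{int}\,C$ at which an outer unit normal vector of $A^\bullet$ lies in $\eta$ (outer normals are unique $\mathcal{H}^{n-1}$-almost everywhere), and $\mathcal{H}^{n-1}$ is $(n-1)$-dimensional Hausdorff measure. The measure $\overline h(A,\cdot)^{1-p}\overline S_{n-1}(A,\cdot)$ on $\omega$ is the measure with density $\overline h(A,\cdot)^{1-p}$ with respect to $\overline S_{n-1}(A,\cdot)$. $\omega\subset\Omega_C$ is a fixed nonempty compact set. $\mathcal{K}(C,\omega)$ is the collection of all closed convex sets $A^\bullet\subseteq C$ that are $C$-determined by $\omega$, i.e. $A^\bullet=C\cap\bigcap_{u\in\omega}H^-(u,h(A^\bullet,u))$. *)

(* Defs.v *)
From HB Require Import structures.
From mathcomp Require Import all_boot all_order all_algebra.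
From mathcomp Require Import all_classical all_reals all_analysis.

Set Implicit Arguments.
Unset Strict Implicit.
Unset Printing Implicit Defensive.

Import Order.TTheory GRing.Theory Num.Theory.
Import numFieldNormedType.Exports.

Local Open Scope classical_set_scope.
Local Open Scope ring_scope.

(* R^n is 'rV[R]_n. The library norm on 'rV[R]_n is the sup norm, which only
   serves here for the topology; lengths and angles come from [dot]. *)

Definition dot (R : realType) (n : nat) (x y : 'rV[R]_n) : R :=
  \sum_(i < n) x ord0 i * y ord0 i.

Definition enorm (R : realType) (n : nat) (x : 'rV[R]_n) : R :=
  Num.sqrt (dot x x).

Definition unit_sphere (R : realType) (n : nat) : set 'rV[R]_n :=
  [set x | enorm x = 1].

Definition unit_ball (R : realType) (n : nat) : set 'rV[R]_n :=
  [set x | enorm x <= 1].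

(* R^n with its Borel sigma-algebra. *)
Definition borelRn (R : realType) (n : nat) :=
  g_sigma_algebraType (@open 'rV[R]_n).

Definition box (R : realType) (n : nat) (a b : 'rV[R]_n) : set 'rV[R]_n :=
  [set x | forall i, a ord0 i <= x ord0 i <= b ord0 i].

(* Lebesgue (outer) measure V_n: infimum of the total volume of countable
   coverings by boxes. The coverings are indexed by an arbitrary set D of
   naturals, so that finite coverings are allowed also when n = 0, where no box
   is empty. *)
Definition volume (R : realType) (n : nat) (E : set 'rV[R]_n) : \bar R :=
  ereal_inf [set v | exists (D : set nat) (a b : nat -> 'rV[R]_n),
    [/\ forall k i, a k ord0 i <= b k ord0 i,
        E `<=` \bigcup_(k in D) box (a k) (b k)
      & v = \esum_(k in D) (\prod_(i < n) (b k ord0 i - a k ord0 i))%:E]].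

Definition diam (R : realType) (n : nat) (U : set 'rV[R]_n) : R :=
  sup [set enorm (z.1 - z.2) | z in U `*` U].

(* The infimum over the coverings of E by sets of diameter at most delta;
   bounding all distances keeps the supremum in [diam] meaningful. *)
Definition hausdorff_delta (R : realType) (n k : nat) (delta : R)
    (E : set 'rV[R]_n) : \bar R :=
  ereal_inf [set v | exists (D : set nat) (U : nat -> set 'rV[R]_n),
    [/\ forall j x y, U j x -> U j y -> enorm (x - y) <= delta,
        E `<=` \bigcup_(j in D) U j
      & v = \esum_(j in D) (diam (U j) ^+ k)%:E]].

(* k-dimensional Hausdorff measure, normalized by V_k(B^k) / 2^k so as to agree
   with V_k on R^k. *)
Definition hausdorff (R : realType) (n k : nat) (E : set 'rV[R]_n) : \bar R :=
  (volume (@unit_ball R k) * ((2%R ^- k)%R : R)%:E *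
   ereal_sup [set hausdorff_delta k delta E | delta in [set d : R | 0%R < d]%R])%E.

Definition pointed_closed_convex_cone (R : realType) (n : nat)
    (C : set 'rV[R]_n) : Prop :=
  [/\ closed C, convex_set C,
      forall x (l : R), C x -> 0 <= l -> C (l *: x)
    & C `&` [set - x | x in C] = [set 0]].

Definition polar (R : realType) (n : nat) (C : set 'rV[R]_n) : set 'rV[R]_n :=
  [set x | forall y, C y -> dot x y <= 0].

Definition Omega (R : realType) (n : nat) (C : set 'rV[R]_n) : set 'rV[R]_n :=
  @unit_sphere R n `&` (polar C)°.

Definition halfspace (R : realType) (n : nat) (u : 'rV[R]_n) (t : R) :
    set 'rV[R]_n :=
  [set x | dot x u <= t].

(* Only used for nonempty B contained in C and u in the interior of polar C,
   where the supremum is that of a nonempty set bounded above by 0. *)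
Definition support_function (R : realType) (n : nat) (B : set 'rV[R]_n)
    (u : 'rV[R]_n) : R :=
  sup [set dot u y | y in B].

Definition coconvex (R : realType) (n : nat) (C A : set 'rV[R]_n) : Prop :=
  [/\ A `<=` C, (volume A < +oo)%E, closed (C `\` A) & convex_set (C `\` A)].

Definition determined (R : realType) (n : nat) (C omega : set 'rV[R]_n)
    (B : set 'rV[R]_n) : Prop :=
  [/\ closed B, convex_set B, B `<=` C
    & B = C `&` \bigcap_(u in omega) halfspace u (support_function B u)].

Definition boundary (T : topologicalType) (B : set T) : set T :=
  closure B `\` B°.

Definition outer_unit_normal (R : realType) (n : nat) (B : set 'rV[R]_n)
    (x u : 'rV[R]_n) : Prop :=
  enorm u = 1 /\ forall y, B y -> dot (y - x) u <= 0.

Definition reverse_gauss (R : realType) (n : nat) (C B eta : set 'rV[R]_n) :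
    set 'rV[R]_n :=
  [set x | (boundary B `&` C°) x /\
           exists2 u, eta u & outer_unit_normal B x u].

Definition hbar (R : realType) (n : nat) (C A : set 'rV[R]_n)
    (u : 'rV[R]_n) : R :=
  - support_function (C `\` A) u.

(* For n = 0 the truncated n.-1 is harmless: the unit sphere of R^0 is empty. *)
Definition surface_area (R : realType) (n : nat) (C A : set 'rV[R]_n)
    (eta : set 'rV[R]_n) : \bar R :=
  hausdorff n.-1 (reverse_gauss C (C `\` A) eta).

(* The measure with density hbar^(1-p) with respect to the surface area measure.
   The library integral is defined for an arbitrary set function; integrating
   over eta included in Omega C, it only uses the values of [surface_area C A]
   on Borel subsets of eta, where it is countably additive. *)
Definition Lp_surface_area (R : realType) (n : nat) (C A : set 'rV[R]_n) (p : R)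
    (eta : set 'rV[R]_n) : \bar R :=
  (\int[surface_area C A : set (borelRn R n) -> \bar R]_(u in eta)
     (hbar C A u `^ (1 - p))%R%:E)%E.

(* Main.v *)
(* Maximum principle. If h2 < l h1 at some point of omega, with l > 1, let U be
   the set of u in omega where this holds; there hbar A2 > l * hbar A1. Fix e <> 0
   in C. A boundary point x of l * (C \ A1) with a normal in U lies outside of
   C \ A2, and moving it along e until it meets C \ A2 leads to a boundary point
   with a normal v in omega; v is in U, because h2 v < <x, v> <= l * h1 v. So
   the projection along e of the part of the boundary of l * (C \ A1) with
   normals in U is contained in that of C \ A2, which is bounded and not null.
   On the other hand hbar A2 > l * hbar A1 on U and the equality of the two
   measures yield S(A2, .) <= l^(p-1) S(A1, .) there. Near a normal u0 both
   boundaries are almost flat, so that their projected area is almost a constant,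
   depending only on u0, times their Hausdorff measure; summing over a fine
   partition of U, the projection for A2 is at most l^(p-1) times the one for A1,
   a contradiction. *)
From HB Require Import structures.
Require Import Defs.
From mathcomp Require Import all_boot all_order all_algebra.
From mathcomp Require Import all_classical all_reals all_analysis.
From mathcomp Require Import measurable_realfun zify ring lra.
Set Implicit Arguments.
Unset Strict Implicit.
Unset Printing Implicit Defensive.
Import Order.TTheory GRing.Theory Num.Theory.
Import numFieldNormedType.Exports.
Local Open Scope classical_set_scope.
Local Open Scope ring_scope.

(** * Hausdorff measures for a seminorm *)

(** The surface area measure is a Hausdorff measure on a curved boundary, while the maximum
    principle compares projections in R^m. The link is made without differentiability of convex
    functions and without an area formula: where all normals are close to [u0], projecting along [e]
    and lifting back to the hyperplane orthogonal to [u0] is bi-Lipschitz with constant near 1. Read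
    in R^m, the Hausdorff measure of that hyperplane is the one of a norm, and the measures of any
    two norms are proportional. The factor belongs to [u0] and [e], not to the sets, so it cancels
    and its value is never computed. The second obstacle is additivity: a point with several normals
    is counted once for each of them. Such points are shown to be null, first for the projected area
    and then for Hausdorff measure, so both are additive over disjoint Borel sets of normals, as
    needed to sum local inequalities. The condition p < 1 enters through l^(1-p) > 1: this gain is
    fixed, while all local errors are factors as close to 1 as desired. *)

Definition diamN (R : realType) (V : zmodType) (N : V -> R) (U : set V) : R :=
  sup [set N (z.1 - z.2) | z in U `*` U].

(* For N = enorm this is convertible to [hausdorff_delta]; other norms are needed
   to compare [hausdorff] on a hyperplane with a measure on R^m. *)
Definition hausN_delta (R : realType) (V : zmodType) (N : V -> R) (k : nat)
    (delta : R) (E : set V) : \bar R :=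
  ereal_inf [set v | exists (D : set nat) (U : nat -> set V),
    [/\ forall j x y, U j x -> U j y -> N (x - y) <= delta,
        E `<=` \bigcup_(j in D) U j
      & v = \esum_(j in D) (diamN N (U j) ^+ k)%:E]].

Definition hausN (R : realType) (V : zmodType) (N : V -> R) (k : nat)
    (E : set V) : \bar R :=
  ereal_sup [set hausN_delta N k delta E | delta in [set d : R | 0 < d]].

Section hausN_theory.
Context (R : realType) (V : zmodType) (N : V -> R) (k : nat).
Hypothesis N_ge0 : forall x, 0 <= N x.

Local Notation Hd := (hausN_delta N k).
Local Notation H := (hausN N k).

Lemma diamN_ge0 U : 0 <= diamN N U.
Proof.
rewrite /diamN; have [/asboolP hU|/asboolPn nU] := boolP `[<has_sup [set N (z.1 - z.2) | z in U `*` U]>].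
  case: (hU) => -[r [z Uz zr]] ub.
  by apply: (le_trans (N_ge0 (z.1 - z.2))); apply: ub_le_sup => //; exists z.
by rewrite sup_out.
Qed.

Lemma diamN_le U d : 0 <= d -> (forall x y, U x -> U y -> N (x - y) <= d) ->
  diamN N U <= d.
Proof.
move=> d0 Ud; rewrite /diamN.
have [->|/set0P[x Ux]] := eqVneq U set0; first by rewrite setX0 image_set0 sup0.
apply: ge_sup; first by exists (N (x - x)), (x, x).
by move=> _ [[y z] [/= Uy Uz] <-]; exact: Ud.
Qed.

Lemma le_diamN U d x y : (forall x y, U x -> U y -> N (x - y) <= d) ->
  U x -> U y -> N (x - y) <= diamN N U.
Proof.
move=> Ud Ux Uy; apply: ub_le_sup; last by exists (x, y).
by exists d => _ [[z t] [/= Uz Ut] <-]; exact: Ud.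
Qed.

Lemma diamNX_ge0 U : (0 <= (diamN N U ^+ k)%:E)%E.
Proof. by rewrite lee_fin exprn_ge0// diamN_ge0. Qed.

(** Index sets other than the naturals are moved into them by [pickle]: pairs serve for countable
    subadditivity, [unit] for a covering by a single set. *)
Lemma hausN_delta_lecount (I : countType) (D : set I) (U : I -> set V) delta E :
  (forall i, D i -> forall x y, U i x -> U i y -> N (x - y) <= delta) ->
  E `<=` \bigcup_(i in D) U i ->
  (Hd delta E <= \esum_(i in D) (diamN N (U i) ^+ k)%:E)%E.
Proof.
move=> Usmall EU; apply: ereal_inf_lbound.
pose U' (j : nat) := if pickle_inv j is Some i then
  if i \in D then U i else set0 else set0.
exists (pickle @` D), U'; split.
- move=> j x y; rewrite /U'; case: (pickle_inv j) => // i.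
  by case: ifPn => // /[!inE] Di; exact: Usmall.
- move=> x /EU[i Di Ux]; exists (pickle i); first by exists i.
  by rewrite /U' pickleK_inv; case: ifPn => // /negP; rewrite inE.
- rewrite esum_image; last by move=> i j _ _; exact: (pcan_inj pickleK).
  by apply: eq_esum => i Di; rewrite /U' pickleK_inv mem_set.
Qed.

Lemma le_hausN_delta delta E (v : \bar R) :
  (forall (D : set nat) (U : nat -> set V),
     (forall j x y, U j x -> U j y -> N (x - y) <= delta) ->
     E `<=` \bigcup_(j in D) U j ->
     (v <= \esum_(j in D) (diamN N (U j) ^+ k)%:E)%E) ->
  (v <= Hd delta E)%E.
Proof. by move=> h; apply: le_ereal_inf_tmp => _ [D [U [? ? ->]]]; exact: h. Qed.

Lemma hausN_delta_ge0 delta E : (0 <= Hd delta E)%E.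
Proof.
by apply: le_hausN_delta => D U _ _; apply: esum_ge0 => j _; exact: diamNX_ge0.
Qed.

Lemma hausN_delta_lehausN delta E : 0 < delta -> (Hd delta E <= H E)%E.
Proof. by move=> d0; apply: ereal_sup_ubound; exists delta. Qed.

Lemma hausN_le E (v : \bar R) :
  (forall delta : R, 0 < delta -> (Hd delta E <= v)%E) -> (H E <= v)%E.
Proof. by move=> h; apply: ge_ereal_sup => _ [d d0 <-]; exact: h. Qed.

Lemma hausN_delta_anti d1 d2 E : d1 <= d2 -> (Hd d2 E <= Hd d1 E)%E.
Proof.
move=> d12; apply: le_hausN_delta => D U Us EU.
apply: hausN_delta_lecount => // i Di x y Ux Uy.
by apply: le_trans d12; exact: Us Ux Uy.
Qed.

Lemma hausN_delta_mono delta : {homo Hd delta : E F / E `<=` F >-> (E <= F)%E}.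
Proof.
move=> E F EF; apply: le_hausN_delta => D U Us EU.
by apply: hausN_delta_lecount => [i _|]; [exact: Us|exact: subset_trans EU].
Qed.

Lemma hausN_delta_diam delta E : 0 <= delta ->
  (forall x y, E x -> E y -> N (x - y) <= delta) ->
  (Hd delta E <= (diamN N E ^+ k)%:E)%E.
Proof.
move=> d0 Ed.
apply: (le_trans (@hausN_delta_lecount unit [set tt] (fun=> E) _ _ _ _)).
- by [].
- by move=> x Ex; exists tt.
- by rewrite esum_set1// diamNX_ge0.
Qed.

Lemma hausN_delta0 delta : Hd delta set0 = 0%E.
Proof.
apply/eqP; rewrite eq_le hausN_delta_ge0 andbT.
apply: (le_trans (@hausN_delta_lecount nat set0 (fun=> set0) _ _ _ _)) => //.
by rewrite esum_set0.
Qed.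

Lemma hausN_delta_sigma_subadditive delta : sigma_subadditive (Hd delta).
Proof.
move=> F.
have [[n0 Fn0]|fin] := pselect (exists n, Hd delta (F n) = +oo%E).
  have /nneseries_pinfty := fun n (_ : xpredT n) => hausN_delta_ge0 delta (F n).
  by move=> /(_ n0 isT Fn0) ->; rewrite leey.
apply/lee_addgt0Pr => e e0.
have F_ge0 n := hausN_delta_ge0 delta (F n).
apply: le_trans (epsilon_trick _ F_ge0 (ltW e0)).
have cov n : exists DU : set nat * (nat -> set V),
  [/\ forall j x y, DU.2 j x -> DU.2 j y -> N (x - y) <= delta,
   F n `<=` \bigcup_(j in DU.1) DU.2 j
   & (\esum_(j in DU.1) (diamN N (DU.2 j) ^+ k)%:E <=
       Hd delta (F n) + (e / (2 ^ n.+1)%:R)%:E)%E].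
  have : Hd delta (F n) \is a fin_num.
    by rewrite ge0_fin_numE// ltey; apply/eqP => h; apply: fin; exists n.
  have en : 0 < e / (2 ^ n.+1)%:R by rewrite divr_gt0// ltr0n expn_gt0.
  move=> /(lb_ereal_inf_adherent en)[_ [D [U [Us FU ->]]] /ltW lt].
  by exists (D, U).
have [G PG] := choice cov.
apply: (le_trans (@hausN_delta_lecount (nat * nat)%type
  [set x | (G x.1).1 x.2] (fun x => (G x.1).2 x.2) _ _ _ _)).
- by move=> x _; case: (PG x.1) => h _ _; exact: h.
- move=> x [n _ Fx]; case: (PG n) => _ /(_ _ Fx)[j Dj Ux] _.
  by exists (n, j).
rewrite (_ : [set x | _] = [set: nat] `*`` (fun n => (G n).1)); last first.
  by apply/seteqP; split => -[a b] /=; [|case].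
rewrite -(@esum_esum _ _ _ setT (fun n => (G n).1)
  (fun n j => (diamN N ((G n).2 j) ^+ k)%:E)); last by move=> *; exact: diamNX_ge0.
rewrite -nneseries_esumT; last first.
  by move=> n; apply: esum_ge0 => *; exact: diamNX_ge0.
apply: lee_nneseries => n *; first by apply: esum_ge0 => *; exact: diamNX_ge0.
by case: (PG n).
Qed.

Lemma hausN_ge0 E : (0 <= H E)%E.
Proof. exact: le_trans (hausN_delta_ge0 _ _) (hausN_delta_lehausN _ ltr01). Qed.

Lemma hausN0 : H set0 = 0%E.
Proof.
apply/eqP; rewrite eq_le hausN_ge0 andbT.
by apply: hausN_le => d _; rewrite hausN_delta0.
Qed.

Lemma hausN_mono : {homo H : E F / E `<=` F >-> (E <= F)%E}.
Proof.
move=> E F EF; apply: hausN_le => d d0.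
exact: le_trans (hausN_delta_mono _ EF) (hausN_delta_lehausN _ d0).
Qed.

Lemma hausN_sigma_subadditive : sigma_subadditive H.
Proof.
move=> F; apply: hausN_le => d d0.
apply: (le_trans (hausN_delta_sigma_subadditive d F)).
apply: lee_nneseries => n *; [exact: hausN_delta_ge0|exact: hausN_delta_lehausN].
Qed.

Definition hausN_om : {outer_measure set V -> \bar R} := HB.pack H
  (isOuterMeasure.Build R V H hausN0 hausN_ge0 hausN_mono hausN_sigma_subadditive).

(** A covering set of diameter less than [r] cannot meet both [E] and [F], so a fine covering of the
    union splits into a covering of each. *)
Lemma hausN_sep E F (r : R) : 0 < r ->
  (forall x y, E x -> F y -> r <= N (x - y)) ->
  (H E + H F <= H (E `|` F))%E.
Proof.
move=> r0 sep.
have key d : 0 < d -> d < r -> (Hd d E + Hd d F <= H (E `|` F))%E.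
  move=> d0 dr; apply: le_trans (hausN_delta_lehausN _ d0).
  apply: le_hausN_delta => D U Us EFU.
  rewrite (esumID [set j | U j `&` E !=set0]); last by move=> *; exact: diamNX_ge0.
  apply: leeD; apply: hausN_delta_lecount.
  - by move=> j _; exact: Us.
  - move=> x Ex; have [j Dj Ujx] := EFU x (or_introl Ex).
    by exists j => //; split => //; exists x.
  - by move=> j _; exact: Us.
  - move=> x Fx; have [j Dj Ujx] := EFU x (or_intror Fx).
    exists j => //; split => // -[y [Uy Ey]].
    by have := le_lt_trans (Us _ _ _ Uy Ujx) dr; rewrite ltNge sep.
(* Two independent scales, so that each supremum over [delta] can be taken while the other term
   stays fixed. *)
have key2 d1 d2 : 0 < d1 -> 0 < d2 -> (Hd d1 E + Hd d2 F <= H (E `|` F))%E.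
  move=> d10 d20; pose d := Num.min (r / 2) (Num.min d1 d2).
  have d0 : 0 < d by rewrite !lt_min divr_gt0// d10 d20.
  apply: le_trans (key d d0 _); last by rewrite gt_min ltr_pdivrMr// ltr_pMr// ltr1n.
  by apply: leeD; apply: hausN_delta_anti; rewrite !ge_min lexx !orbT.
have [->|Z] := eqVneq (H (E `|` F)) +oo%E; first by rewrite leey.
have fin G : G `<=` E `|` F -> H G \is a fin_num.
  move=> GEF; rewrite ge0_fin_numE ?hausN_ge0//.
  by apply: le_lt_trans (hausN_mono GEF) _; rewrite ltey.
have fE := fin E (@subsetUl _ E F).
have fF := fin F (@subsetUr _ E F).
rewrite -leeBrDr//; apply: hausN_le => d1 d10.
rewrite leeBrDr// addeC.
have fd1 : Hd d1 E \is a fin_num.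
  rewrite ge0_fin_numE ?hausN_delta_ge0//.
  by apply: le_lt_trans (hausN_delta_lehausN _ d10) _; rewrite ltey_eq fE.
rewrite -leeBrDr//; apply: hausN_le => d2 d20.
by rewrite leeBrDr// addeC; exact: key2.
Qed.

End hausN_theory.

Section Lipschitz.
Context (R : realType) (V W : zmodType) (N : V -> R) (M : W -> R) (k : nat).
Hypothesis N_ge0 : forall x, 0 <= N x.
Hypothesis M_ge0 : forall x, 0 <= M x.

Lemma esum_pZl (I : choiceType) (D : set I) (a : I -> \bar R) (c : R) :
  0 <= c -> (forall i, (0 <= a i)%E) ->
  (\esum_(i in D) (c%:E * a i) <= c%:E * \esum_(i in D) a i)%E.
Proof.
move=> c0 a0; apply: ge_ereal_sup => _ [X [finX XD] <-].
rewrite [X in (X <= _)%E](_ : _ = c%:E * \sum_(i \in X) a i)%E; last first.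
  by rewrite ge0_mule_fsumr.
by apply: lee_wpmul2l; [rewrite lee_fin|apply: ereal_sup_ubound; exists X].
Qed.

(** The images of the traces of the covering sets on [E] cover the image. The scale stays visible
    because the self-similarity of the cube relates two different values of [delta]. *)
Lemma hausN_delta_image (E : set V) (f : V -> W) (L d : R) : 0 < L -> 0 <= d ->
  (forall x y, E x -> E y -> M (f x - f y) <= L * N (x - y)) ->
  (hausN_delta M k (L * d) (f @` E) <= (L ^+ k)%:E * hausN_delta N k d E)%E.
Proof.
move=> L0 d0 fL; have Lk := exprn_gt0 k L0.
rewrite -lee_pdivrMl//; apply: le_hausN_delta => D U Us EU.
rewrite lee_pdivrMl//.
apply: (@le_trans _ _ (\esum_(j in D) ((L ^+ k)%:E * (diamN N (U j) ^+ k)%:E))%E).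
  apply: (@le_trans _ _ (\esum_(j in D) ((diamN M (f @` (E `&` U j)) ^+ k)%:E))%E).
    apply: hausN_delta_lecount => //.
      move=> j Dj _ _ [x [Ex Ux] <-] [y [Ey Uy] <-].
      by apply: le_trans (fL _ _ Ex Ey) _; rewrite ler_pM2l//; exact: Us Ux Uy.
    by move=> _ [x Ex <-]; have [j Dj Ux] := EU x Ex; exists j => //; exists x.
  apply: le_esum => j Dj; rewrite -EFinM lee_fin -exprMn lerXn2r// ?nnegrE//.
  - exact: diamN_ge0.
  - by rewrite mulr_ge0 ?diamN_ge0// ltW.
  apply: diamN_le; first by rewrite mulr_ge0 ?diamN_ge0// ltW.
  move=> _ _ [x [Ex Ux] <-] [y [Ey Uy] <-].
  apply: le_trans (fL _ _ Ex Ey) _; rewrite ler_pM2l//.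
  by apply: (@le_diamN _ _ _ _ d) => //; exact: Us.
apply: esum_pZl; first exact: ltW.
by move=> *; exact: diamNX_ge0.
Qed.

Lemma hausN_image (E : set V) (f : V -> W) (L : R) : 0 < L ->
  (forall x y, E x -> E y -> M (f x - f y) <= L * N (x - y)) ->
  (hausN M k (f @` E) <= (L ^+ k)%:E * hausN N k E)%E.
Proof.
move=> L0 fL; apply: hausN_le => d d0.
have dL : d = L * (d / L) by rewrite mulrC divfK// gt_eqF.
rewrite dL; apply: le_trans (hausN_delta_image L0 _ fL) _.
  by rewrite divr_ge0// ltW.
apply: lee_wpmul2l; first by rewrite lee_fin exprn_ge0// ltW.
by apply: hausN_delta_lehausN; rewrite divr_gt0.
Qed.

(** Coverings of the image are pulled back: the expansion bound controls the diameter of the trace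
    on [E] of a preimage, so no inverse map has to be constructed. *)
Lemma hausN_preimage (E : set V) (f : V -> W) (L : R) : 0 < L ->
  (forall x y, E x -> E y -> N (x - y) <= L * M (f x - f y)) ->
  (hausN N k E <= (L ^+ k)%:E * hausN M k (f @` E))%E.
Proof.
move=> L0 fL; have Lk := exprn_gt0 k L0.
apply: hausN_le => d d0.
have dL0 : 0 < d / L by rewrite divr_gt0.
apply: (@le_trans _ _ ((L ^+ k)%:E * hausN_delta M k (d / L) (f @` E))%E); last first.
  apply: lee_wpmul2l; first by rewrite lee_fin ltW.
  exact: hausN_delta_lehausN.
rewrite -lee_pdivrMl//; apply: le_hausN_delta => D U Us EU.
rewrite lee_pdivrMl//.
have small j x y : E x -> E y -> U j (f x) -> U j (f y) ->
    N (x - y) <= L * diamN M (U j).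
  move=> Ex Ey Ux Uy; apply: le_trans (fL _ _ Ex Ey) _; rewrite ler_pM2l//.
  by apply: (@le_diamN _ _ _ _ (d / L)) => //; exact: Us.
apply: (@le_trans _ _ (\esum_(j in D) ((L ^+ k)%:E * (diamN M (U j) ^+ k)%:E))%E).
  apply: (@le_trans _ _ (\esum_(j in D) ((diamN N (E `&` f @^-1` (U j)) ^+ k)%:E))%E).
    apply: hausN_delta_lecount => //.
      move=> j Dj x y [Ex Ux] [Ey Uy].
      apply: le_trans (fL _ _ Ex Ey) _; rewrite mulrC -ler_pdivlMr//.
      exact: Us Ux Uy.
    by move=> x Ex; have [j Dj Ux] := EU (f x) (imageP f Ex); exists j.
  apply: le_esum => j Dj; rewrite -EFinM lee_fin -exprMn lerXn2r// ?nnegrE//.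
  - exact: diamN_ge0.
  - by rewrite mulr_ge0 ?diamN_ge0// ltW.
  apply: diamN_le; first by rewrite mulr_ge0 ?diamN_ge0// ltW.
  by move=> x y [Ex Ux] [Ey Uy]; exact: small Ux Uy.
apply: esum_pZl; first exact: ltW.
by move=> *; exact: diamNX_ge0.
Qed.

End Lipschitz.

(** * Metric outer measures *)

(* Additivity on sets at positive distance: Caratheodory's criterion makes closed
   sets measurable for such an outer measure. *)
Definition metric_om (R : realType) (V : zmodType) (N : V -> R)
    (mu : set V -> \bar R) := forall (E F : set V) (r : R), 0 < r ->
  (forall x y, E x -> F y -> r <= N (x - y)) ->
  (mu E + mu F <= mu (E `|` F))%E.

Section metric_outer_measure.
Context (R : realType) (V : zmodType) (N : V -> R).
Hypothesis N_triangle : forall x y, N (x + y) <= N x + N y.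
Variable mu : {outer_measure set V -> \bar R}.
Hypothesis mu_metric : metric_om N mu.

Section criterion.
Variables (F X : set V).
Hypothesis F_closed : forall x, ~ F x -> exists2 r : R, 0 < r & forall y, F y -> r <= N (x - y).

Let A (k : nat) : set V :=
  [set x | X x /\ ~ F x /\ forall y, F y -> (k.+1%:R)^-1 <= N (x - y)].
Let Q (k : nat) : set V := A k.+2 `\` A k.+1.

Let A_mono k : A k `<=` A k.+1.
Proof.
move=> x [Xx [nFx h]]; split => //; split => // y /h; apply: le_trans.
by rewrite lef_pV2 ?posrE// ler_nat.
Qed.

Let AX k : A k `<=` X. Proof. by move=> x []. Qed.

(** A point of [Q k] fails the condition of [A k.+1], hence is closer than 1/(k+2) to some point of
    [F], whereas [A k] keeps distance 1/(k+1) from [F]. *)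
Let AQ_sep k : (mu (A k) + mu (Q k) <= mu (A k.+2))%E.
Proof.
pose r : R := (k.+1%:R)^-1 - (k.+2%:R)^-1.
have r0 : 0 < r by rewrite subr_gt0 ltf_pV2 ?posrE// ltr_nat.
apply: (le_trans (mu_metric r0 _)); last first.
  by apply: le_outer_measure => x [/A_mono/A_mono//|[]].
move=> x y [_ [_ hx]] [[Xy [nFy _]] nAy].
have [z Fz Nyz] : exists2 z, F z & N (y - z) < (k.+2%:R)^-1.
  apply: contrapT => h; apply: nAy; split => //; split => // z Fz.
  by rewrite leNgt; apply/negP => lt; apply: h; exists z.
have := N_triangle (x - y) (y - z).
rewrite (_ : x - y + (y - z) = x - z); last by rewrite addrA subrK.
move: (hx z Fz) Nyz; rewrite /r.
move: (_^-1) (_^-1) (N _) (N _) (N _) => a b c d e; lra.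
Qed.

(** Layers whose indices differ by two are separated: even layers accumulate inside [A n.*2], odd
    ones inside [A n.*2.+1]. Both lie in [X], so the series of the layers converges when [mu X] is
    finite. *)
Let Q_sum n : (\sum_(0 <= i < n.*2) mu (Q i) <= mu (A n.*2) + mu (A n.*2.+1))%E.
Proof.
elim: n => [|n ih]; first by rewrite big_geq// adde_ge0// outer_measure_ge0.
rewrite doubleS !big_nat_recr//= -addeA.
apply: (@le_trans _ _ ((mu (A n.*2) + mu (A n.*2.+1)) +
  (mu (Q n.*2) + mu (Q n.*2.+1)))%E); first exact: leeD2r.
by rewrite addeACA; exact: leeD.
Qed.

Lemma metric_caratheodory_le : (mu (X `&` F) + mu (X `&` ~` F) <= mu X)%E.
Proof.
have [->|Xoo] := eqVneq (mu X) +oo%E; first by rewrite leey.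
have muX : mu X \is a fin_num.
  by rewrite ge0_fin_numE ?outer_measure_ge0// ltey.
have Qoo : (\sum_(0 <= i <oo) mu (Q i) < +oo)%E.
  apply: (@le_lt_trans _ _ (mu X + mu X)%E); last first.
    by rewrite lte_add_pinfty// ltey_eq muX.
  apply: lime_le; first by apply: is_cvg_nneseries => *; exact: outer_measure_ge0.
  apply: nearW => n; apply: (@le_trans _ _ (\sum_(0 <= i < n.*2) mu (Q i))%E).
    apply: lee_sum_nneg_natr => [i _ _|]; first exact: outer_measure_ge0.
    by rewrite -addnn leq_addr.
  by apply: (le_trans (Q_sum n)); apply: leeD; apply: le_outer_measure; exact: AX.
have tail := nneseries_tail_cvg Qoo (fun k _ => outer_measure_ge0 mu (Q k)).
have bound k : (mu (X `&` F) + mu (X `&` ~` F) <=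
    mu X + \sum_(k <= i <oo) mu (Q i))%E.
  (* Each point of [X] off [F] lies in some [A n]; the least such [n] places it in [A k.+1] or in a
     layer of the tail, whose total measure tends to 0. *)
  have : (mu (X `&` ~` F) <= mu (A k.+1) + \sum_(k <= i <oo) mu (Q i))%E.
    apply: (@le_trans _ _ (mu (A k.+1 `|` \bigcup_i Q (i + k)%N))).
      apply: le_outer_measure => x [Xx nFx].
      have [r r0 hr] := F_closed nFx.
      have exA : exists n, `[< A n x >].
        exists (Num.truncn r^-1); apply/asboolP; split => //; split => // y Fy.
        apply: le_trans (hr y Fy); rewrite invf_ple ?posrE//.
        by apply: ltW; rewrite truncnS_gt.
      have AxW m n : (m <= n)%N -> A m x -> A n x.
        move=> /subnK <-; elim: (n - m)%N => // j ih Amx.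
        by rewrite addSn; apply: A_mono; exact: ih.
      have [le|gt] := leqP (ex_minn exA) k.+1.
        by left; move: le; case: ex_minnP => m /asboolP Am _ le; exact: AxW Am.
      right; move: gt; case: ex_minnP => m /asboolP Am mmin km.
      exists (m - k.+2)%N => //; split.
        have -> : (m - k.+2 + k).+2 = m by rewrite -!addnS subnK.
        exact: Am.
      move=> /asboolP/mmin; lia.
    apply: (le_trans (outer_measureU2 _ _ _)); apply: leeD2l.
    apply: (le_trans (outer_measure_sigma_subadditive mu _)).
    by rewrite -(nneseries_addn (f := fun i => mu (Q i)))// => i; exact: outer_measure_ge0.
  move=> /(leeD2l (mu (X `&` F)))/le_trans; apply; rewrite addeA; apply: leeD2r.
  rewrite addeC; apply: (@le_trans _ _ (mu (A k.+1 `|` (X `&` F)))).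
    apply: (@mu_metric _ _ ((k.+2%:R)^-1)); first by rewrite invr_gt0.
    by move=> x y [_ [_ h]] [_ Fy]; exact: h.
  by apply: le_outer_measure => x [[]//|[]].
apply/lee_addgt0Pr => e e0.
have /fine_cvgP[_ /cvgr0_norm_lt /(_ _ e0)] := tail.
have /fine_cvgP[tfin _] := tail => te.
near \oo => k.
apply: (le_trans (bound k)); apply: leeD2l.
have fk : (\sum_(k <= i <oo) mu (Q i))%E \is a fin_num by near: k.
rewrite -(fineK fk) lee_fin ltW//; apply: le_lt_trans (ler_norm _) _.
by near: k.
Unshelve. all: by end_near. Qed.

End criterion.

Lemma metric_caratheodory (F : set V) :
  (forall x, ~ F x -> exists2 r : R, 0 < r & forall y, F y -> r <= N (x - y)) ->
  mu.-caratheodory F.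
Proof. by move=> hF; apply: le_caratheodory_measurable => X; exact: metric_caratheodory_le. Qed.

End metric_outer_measure.

(** * Lebesgue measure of a cube *)

Section cube_volume.
Context (R : realType).
Local Notation leb := (@lebesgue_measure R).

Lemma lebesgue_measure_segment (a b : R) : a <= b ->
  leb `[a, b]%classic = (b - a)%:E.
Proof.
move=> ab; apply: (etrans (lebesgue_measure_itv `[a, b])) => /=.
by rewrite lte_fin; move: ab; rewrite le_eqVlt => /predU1P[->|->]; rewrite ?ltxx ?subrr.
Qed.

(** The pointwise bound is integrated over [0, s]; sum and integral are exchanged, and each
    indicator contributes at most the length of its interval. *)
Lemma itv_cover_le (s v : R) (c l u : nat -> R) : 0 <= s -> 0 <= v ->
  (forall j, 0 <= c j) -> (forall j, l j <= u j) ->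
  (forall t : R, 0 <= t <= s ->
    (v%:E <= \sum_(j <oo) ((c j * \1_(`[l j, u j]%classic) t)%R : R)%:E)%E) ->
  ((s * v)%:E <= \sum_(j <oo) (c j * (u j - l j))%:E)%E.
Proof.
move=> s0 v0 c0 lu cov.
have mterm j : measurable_fun [set: measurableTypeR R]
    (fun t : measurableTypeR R => ((c j * \1_(`[l j, u j]%classic) t)%R : R)%:E).
  by apply/measurable_EFinP; apply: measurable_funM.
have term0 j (t : R) : (0 <= ((c j * \1_(`[l j, u j]%classic) t)%R : R)%:E)%E.
  by rewrite lee_fin mulr_ge0.
have -> : (s * v)%:E = (\int[leb]_(t in `[0%R, s]%classic) v%:E)%E.
  rewrite integral_cst// mulrC EFinM; congr (_ * _)%E.
  by rewrite -[in LHS](subr0 s) -lebesgue_measure_segment.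
apply: (@le_trans _ _ (\int[leb]_(t in `[0%R, s]%classic)
   \sum_(j <oo) ((c j * \1_(`[l j, u j]%classic) t)%R : R)%:E)%E).
  apply: ge0_le_integral => //.
  apply: ge0_emeasurable_sum => // j _; exact: measurable_funTS.
rewrite integral_nneseries//; last by move=> j; exact: measurable_funTS.
apply: lee_nneseries => j _; first by move=> _; apply: integral_ge0 => *; exact: term0.
under eq_integral do rewrite EFinM.
rewrite ge0_integralZl_EFin//; last first.
  by apply/measurable_EFinP; exact: measurable_funTS.
rewrite EFinM; apply: lee_wpmul2l; first by rewrite lee_fin.
rewrite integral_indic//.
apply: (@le_trans _ _ (leb `[l j, u j]%classic)).
  by apply: le_measure; rewrite ?inE//; exact: measurableI.
by rewrite [leLHS]lebesgue_measure_segment.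
Qed.

(* The covering inequality [1 <= sum of the indicators] is integrated one
   coordinate at a time: in [W l] the first [l] indicators are replaced by the
   lengths of their intervals. *)
Lemma volume_cube_ge (n : nat) (s : R) (E : set 'rV[R]_n) : 0 <= s ->
  (forall x : 'rV[R]_n, (forall i, 0 <= x ord0 i <= s) -> E x) ->
  ((s ^+ n)%:E <= volume E)%E.
Proof.
move=> s0 cubeE; apply: le_ereal_inf_tmp => _ [D [a [b [ab Ecov ->]]]].
pose W l (x : 'rV[R]_n) j := \prod_(i < n) (if (i < l)%N then b j ord0 i - a j ord0 i
  else \1_(`[a j ord0 i, b j ord0 i]%classic) (x ord0 i)).
have W0 l x j : 0 <= W l x j.
  by apply: prodr_ge0 => i _; case: ifP => // _; rewrite subr_ge0.
have WD l x : (\sum_(j <oo | j \in D) (W l x j)%:E =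
    \sum_(j <oo) ((j \in D)%:R * W l x j)%:E)%E.
  rewrite eseries_mkcond; apply: eq_eseriesr => j _.
  by case: ifP => _; rewrite ?mul1r ?mul0r.
suff claim l : (l <= n)%N -> forall x : 'rV[R]_n,
    (forall i, 0 <= x ord0 i <= s) ->
    ((s ^+ l)%:E <= \sum_(j <oo | j \in D) (W l x j)%:E)%E.
  have := claim n (leqnn n) 0 _; rewrite nneseries_esum; last by move=> j _; rewrite lee_fin.
  rewrite [X in \esum_(j in X) _](_ : _ = D); last by apply/seteqP; split => j /=; rewrite inE.
  rewrite (_ : \esum_(j in D) (W n 0 j)%:E = \esum_(j in D) (\prod_(i < n) (b j ord0 i - a j ord0 i))%:E)%E; last first.
    by apply: eq_esum => j _; congr EFin; apply: eq_bigr => i _; rewrite ltn_ord.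
  by apply => i; rewrite mxE lexx s0.
elim: l => [_ x xs|l ih ln x xs].
  have [j Dj xj] := Ecov x (cubeE x xs).
  rewrite WD; apply: le_trans (nneseries_lim_ge j.+1 _); last by move=> *; rewrite lee_fin mulr_ge0.
  rewrite big_nat_recr//= mem_set// mul1r.
  have -> : W 0 x j = 1.
    rewrite /W big1// => i _ /=; rewrite indicE mem_set//=.
    by rewrite in_itv/=; exact: xj.
  rewrite expr0 leeDr// sume_ge0// => *; by rewrite lee_fin mulr_ge0.
pose il := Ordinal ln.
(* The term without its factor for coordinate [l]; it is constant in that coordinate, the one
   integrated at this stage. *)
pose c j := (j \in D)%:R * \prod_(i < n | i != il) (if (i < l)%N then b j ord0 i - a j ord0 i
  else \1_(`[a j ord0 i, b j ord0 i]%classic) (x ord0 i)).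
rewrite WD exprS.
rewrite (eq_eseriesr (g := fun j => (c j * (b j ord0 il - a j ord0 il))%:E)); last first.
  move=> j _; rewrite /c /W (bigD1 il)//= ltnS leqnn -mulrA; congr (_%:R * _)%:E.
  rewrite mulrC; congr (_ * _); apply: eq_bigr => i ni.
  rewrite ltnS leq_eqVlt; have -> // : (i == l :> nat) = false.
  by apply/negbTE; apply: contra ni => /eqP il'; apply/eqP/val_inj.
apply: itv_cover_le => //.
- exact: exprn_ge0.
- move=> j; rewrite mulr_ge0// prodr_ge0// => i _; case: ifP => // _.
  by rewrite subr_ge0.
move=> t ts.
pose y : 'rV[R]_n := \row_i (if i == il then t else x ord0 i).
have := ih (ltnW ln) y; rewrite WD => h.
apply: (le_trans (h _)).
  by move=> i; rewrite mxE; case: ifP.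
rewrite le_eqVlt; apply/orP; left; apply/eqP; apply: eq_eseriesr => j _.
congr EFin; rewrite /c /W (bigD1 il)//= ltnn mxE eqxx -mulrA; congr (_ * _).
rewrite mulrC; congr (_ * _); apply: eq_bigr => i ni.
by rewrite mxE (negbTE ni).
Qed.

End cube_volume.

(** * Hausdorff measures of two norms are proportional *)

Lemma outer_measure_finite_cover (R : realType) (T : Type) (I : finType)
    (mu : {outer_measure set T -> \bar R}) (E : set T) (F : I -> set T) :
  (forall x, E x -> exists i, F i x) -> (mu E <= \sum_i mu (F i))%E.
Proof.
move=> EF; apply: (@le_trans _ _ (mu (\big[setU/set0]_(i : I) F i))).
  apply: le_outer_measure => x /EF[i Fix].
  by rewrite (bigD1 i)//; left.
elim/big_ind2 : _ => //; first by rewrite outer_measure0.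
move=> A a B b Aa Bb; apply: (le_trans (outer_measureU2 _ _ _)); exact: leeD.
Qed.

Lemma hausN_metric (R : realType) (V : zmodType) (N : V -> R) (k : nat)
  (N_ge0 : forall x, 0 <= N x) : metric_om N (hausN_om k N_ge0).
Proof. by move=> E F r; exact: hausN_sep. Qed.

Section norms.
Context (R : realType) (m : nat).
Implicit Types (N : 'rV[R]_m -> R) (a x y : 'rV[R]_m).

Record is_norm N : Prop := IsNorm {
  norm_ge0 : forall x, 0 <= N x ;
  norm_opp : forall x, N (- x) = N x ;
  norm_triangle : forall x y, N (x + y) <= N x + N y ;
  norm_scale : forall (t : R) x, N (t *: x) = `|t| * N x ;
  norm_equiv : exists2 c, 0 < c & forall x, N x <= c * `|x| /\ `|x| <= c * N x }.

Definition supn x : R := `|x|.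

Lemma supn_norm : is_norm supn.
Proof.
split => //.
- by move=> x; exact: normr_ge0.
- by move=> x; rewrite /supn normrN.
- by move=> x y; exact: ler_normD.
- by move=> t x; rewrite /supn normrZ.
- by exists 1 => // x; rewrite mul1r.
Qed.

Lemma supn_ge0 x : 0 <= supn x. Proof. exact: normr_ge0. Qed.

Lemma supn_le x (d : R) : 0 <= d -> (supn x <= d) <-> (forall i, `|x ord0 i| <= d).
Proof.
move=> d0; rewrite /supn [`|x|]mx_normrE; split.
  move=> h i; apply: le_trans h.
  by apply: (@le_bigmax _ _ _ 0 (fun i => `|x i.1 i.2|) (ord0, i)).
move=> h; apply: bigmax_le => // -[i j] _; rewrite ord1; exact: h.
Qed.

Lemma coord_le_supn x i : `|x ord0 i| <= supn x.
Proof. by have [h _] := @supn_le x _ (supn_ge0 x); exact: h. Qed.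

Definition Qcube : set 'rV[R]_m := box 0 (const_mx 1).

Definition affine a (s : R) x := a + s *: x.

Lemma box_affine a (s : R) : 0 < s ->
  box a (a + const_mx s) `<=` affine a s @` Qcube.
Proof.
move=> s0 x hx; exists (s^-1 *: (x - a)).
  move=> i; rewrite !mxE; have := hx i; rewrite !mxE => /andP[h1 h2].
  rewrite mulr_ge0 ?subr_ge0 ?invr_ge0 ?(ltW s0)//=.
  by rewrite mulrC ler_pdivrMr// mul1r lerBlDl.
by rewrite /affine scalerA divff ?gt_eqF// scale1r addrC subrK.
Qed.

Lemma bounded_sub_box (U : set 'rV[R]_m) (d : R) : 0 <= d ->
  (forall x y, U x -> U y -> supn (x - y) <= d) ->
  exists a, U `<=` box a (a + const_mx d).
Proof.
move=> d0 Ud; have [->|/set0P[x0 Ux0]] := eqVneq U set0; first by exists 0.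
exists (\row_i inf [set x ord0 i | x in U]) => x Ux i; rewrite !mxE.
have lb y : U y -> y ord0 i - d <= x ord0 i /\ x ord0 i - d <= y ord0 i.
  move=> Uy; have [/(_ (Ud x y Ux Uy) i) + _] := @supn_le (x - y) d d0; rewrite !mxE.
  by rewrite ler_norml => /andP[? ?]; split; lra.
apply/andP; split.
  apply: ge_inf; last by exists x.
  by exists (x ord0 i - d) => _ [y Uy <-]; case: (lb y Uy).
rewrite -lerBlDr; apply: lb_le_inf; first by exists (x ord0 i), x.
by move=> _ [y Uy <-]; case: (lb y Uy).
Qed.

(** A set of sup-diameter d fits into a cube of side d, whose volume is exactly the weight d^m of
    the set. *)
Lemma volume_le_hausN (E : set 'rV[R]_m) : (volume E <= hausN supn m E)%E.
Proof.
apply: le_trans (hausN_delta_lehausN supn m E (ltr01 : (0 : R) < 1)).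
apply: le_hausN_delta => D U Us EU.
have Ub j : exists a, U j `<=` box a (a + const_mx (diamN supn (U j))).
  apply: bounded_sub_box; first exact: (diamN_ge0 supn_ge0).
  by move=> x y Ux Uy; exact: (le_diamN (Us j)) Ux Uy.
have [a ha] := choice Ub.
apply: ereal_inf_lbound; exists D, a, (fun j => a j + const_mx (diamN supn (U j))).
split.
- by move=> j i; rewrite !mxE lerDl; exact: (diamN_ge0 supn_ge0).
- by move=> x /EU[j Dj Ux]; exists j => //; exact: ha.
- apply: eq_esum => j _; congr EFin.
  rewrite (eq_bigr (fun=> diamN supn (U j))) ?prodr_const ?card_ord// => i _.
  by rewrite !mxE addrAC subrr add0r.
Qed.

Section one_norm.
Variable N : 'rV[R]_m -> R.
Hypothesis hN : is_norm N.
Let N_ge0 := norm_ge0 hN.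
Local Notation H := (hausN N m).
Local Notation Hd := (hausN_delta N m).

Lemma norm_affine a s x y : 0 <= s -> N (affine a s x - affine a s y) <= s * N (x - y).
Proof.
by move=> s0; rewrite /affine opprD addrACA subrr add0r -scalerBr (norm_scale hN) ger0_norm.
Qed.

(* Self-similarity: Q is the union of k^m copies of itself scaled by 1/k. *)
Lemma hausN_Q_le_delta (delta : R) : 0 < delta -> (H Qcube <= Hd delta Qcube)%E.
Proof.
move=> delta0; apply: hausN_le => d d0.
have [k hk] : exists k, delta / k.+1%:R <= d.
  exists (Num.truncn (delta / d)); rewrite ler_pdivrMr// mulrC -ler_pdivrMr//.
  by rewrite ltW// truncnS_gt.
pose s : R := k.+1%:R^-1; have s0 : 0 < s by rewrite invr_gt0.
pose Hd_om : {outer_measure set 'rV[R]_m -> \bar R} := HB.pack (Hd (s * delta))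
  (isOuterMeasure.Build R _ (Hd (s * delta)) (hausN_delta0 m N_ge0 _)
   (hausN_delta_ge0 m N_ge0 _) (@hausN_delta_mono _ _ _ m _)
   (hausN_delta_sigma_subadditive m N_ge0 _)).
pose F (g : {ffun 'I_m -> 'I_k.+1}) := affine (\row_i ((g i)%:R * s)) s @` Qcube.
apply: (@le_trans _ _ (Hd_om Qcube)).
  by apply: hausN_delta_anti; rewrite mulrC.
apply: (@le_trans _ _ (\sum_g Hd_om (F g))%E).
  apply: outer_measure_finite_cover => x Qx.
  have tr_lt i : (Num.truncn (x ord0 i * k.+1%:R) <= k.+1)%N.
    rewrite -(ler_nat R); apply: (@le_trans _ _ (x ord0 i * k.+1%:R)).
      by rewrite truncn_le mulr_ge0//; have := Qx i; rewrite !mxE => /andP[].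
    by rewrite ler_piMl//; have := Qx i; rewrite !mxE => /andP[].
  (* The subcube is found by rounding down; [minn k] handles the face where the coordinate is 1 and
     rounding would give [k.+1]. *)
  exists [ffun i => inord (minn k (Num.truncn (x ord0 i * k.+1%:R)))].
  apply: (@box_affine _ s s0) => i; rewrite !mxE ffunE inordK; last first.
    by rewrite ltnS geq_minl.
  have := Qx i; rewrite !mxE => /andP[x0 x1].
  rewrite /s -[X in _ <= _ <= _ + X]mul1r -mulrDl ler_pdivrMr// ler_pdivlMr//.
  have := truncn_itv (mulr_ge0 x0 (ler0n R k.+1)) => /andP[t1 t2].
  have := tr_lt i; set t := Num.truncn _ in t1 t2 * => tk.
  have [kt|tk'] := leqP k t.
    by rewrite (le_trans _ t1) ?ler_nat//= natr1 ler_piMl.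
  by rewrite t1 natr1 ltW.
apply: (@le_trans _ _ (\sum_(g : {ffun 'I_m -> 'I_k.+1}) ((s ^+ m)%:E * Hd delta Qcube))%E).
  apply: lee_sum => g _; apply: hausN_delta_image => //; first exact: ltW.
  by move=> x y _ _; apply: norm_affine; exact: ltW.
rewrite -ge0_sume_distrl; last by move=> *; rewrite lee_fin exprn_ge0// ltW.
rewrite sumEFin sumr_const card_ffun !card_ord -mulr_natl.
by rewrite natrX -exprMn /s divff ?expr1n ?mul1e// pnatr_eq0.
Qed.


Let equiv : exists2 c : R, 0 < c & forall x, N x <= c * supn x /\ supn x <= c * N x.
Proof. by case: hN. Qed.

Lemma Qcube_diam x y : Qcube x -> Qcube y -> supn (x - y) <= 1.
Proof.
move=> Qx Qy; apply/supn_le => // i.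
have := Qx i; have := Qy i; rewrite !mxE ler_norml => /andP[? ?] /andP[? ?].
by apply/andP; split; lra.
Qed.

Lemma hausN_Q_fin : (H Qcube < +oo)%E.
Proof.
have [c c0 hc] := equiv.
apply: le_lt_trans (hausN_Q_le_delta c0) _.
apply: le_lt_trans (hausN_delta_diam m N_ge0 (ltW c0) _) (ltry _).
move=> x y Qx Qy; apply: (le_trans (proj1 (hc _))).
by rewrite ler_piMr ?(ltW c0)//; exact: Qcube_diam.
Qed.

Lemma hausN_sup_equiv : exists2 c : R, 0 < c & forall E, (hausN supn m E <= c%:E * H E)%E.
Proof.
have [c c0 hc] := equiv.
exists (c ^+ m) => [|E]; first exact: exprn_gt0.
have := @hausN_preimage R _ _ supn N m supn_ge0 N_ge0 E id c c0.
by rewrite image_id; apply => x y _ _; case: (hc (x - y)).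
Qed.

Lemma hausN_Q_gt0 : (0 < H Qcube)%E.
Proof.
have [c c0 hc] := hausN_sup_equiv.
have Q1 : (1 <= volume Qcube)%E.
  have := @volume_cube_ge R m 1 Qcube ler01 _; rewrite expr1n; apply => x hx i.
  by rewrite !mxE; exact: hx.
have : (0 < c%:E * H Qcube)%E.
  apply: lt_le_trans (hc _); apply: lt_le_trans (volume_le_hausN _).
  by apply: lt_le_trans Q1.
by rewrite pmule_rgt0// lte_fin.
Qed.

(** Proves to be the proportionality factor between the measure of [N] and that of the sup norm, see
    [hausN_sup]. *)
Definition haus_ratio : R := fine (H Qcube).

Lemma hausN_Qcube : H Qcube = haus_ratio%:E.
Proof. by rewrite fineK// ge0_fin_numE ?hausN_Q_fin// hausN_ge0. Qed.

Lemma haus_ratio_gt0 : 0 < haus_ratio.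
Proof. by rewrite -lte_fin -hausN_Qcube hausN_Q_gt0. Qed.

Lemma hausN_affine a s E : 0 < s -> (H (affine a s @` E) <= (s ^+ m)%:E * H E)%E.
Proof.
by move=> s0; apply: hausN_image => // x y _ _; apply: norm_affine; exact: ltW.
Qed.

Lemma hausN_sub_cube (U : set 'rV[R]_m) (d : R) : 0 <= d ->
  (forall x y, U x -> U y -> supn (x - y) <= d) ->
  (H U <= (d ^+ m * haus_ratio)%:E)%E.
Proof.
move=> d0 Ud; move: d0; rewrite le_eqVlt => /predU1P[d0|d0].
  (* For [m = 0] the bound is 0^0 = 1 times the measure of the one-point space; for [m > 0] a set of
     diameter 0 is null. *)
  have [m0|m0] := posnP m.
    rewrite (_ : d ^+ m = 1) ?mul1r -?hausN_Qcube; last by rewrite m0.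
    apply: hausN_mono => // x _ i.
    by exfalso; have := ltn_ord i; move: (i : nat) => j; rewrite m0.
  rewrite -d0 expr0n gtn_eqF// mul0r; apply: hausN_le => e e0.
  have Uz x y : U x -> U y -> N (x - y) <= 0.
    move=> Ux Uy; have [c c0 hc] := equiv; apply: (le_trans (proj1 (hc _))).
    by rewrite pmulr_rle0// d0; exact: Ud.
  have Ue x y : U x -> U y -> N (x - y) <= e.
    by move=> Ux Uy; apply: le_trans (ltW e0); exact: Uz.
  apply: (le_trans (hausN_delta_diam m N_ge0 (ltW e0) Ue)).
  have -> : diamN N U = 0.
    by apply/eqP; rewrite eq_le diamN_ge0// andbT; exact: diamN_le.
  by rewrite expr0n gtn_eqF.
have [a Ua] := bounded_sub_box (ltW d0) Ud.
rewrite EFinM -hausN_Qcube; apply: le_trans (hausN_affine a Qcube d0).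
apply: hausN_mono => //; apply: (subset_trans Ua); exact: box_affine.
Qed.

(** Each set of a covering lies in a cube, whose N-measure is known by scaling. *)
Lemma hausN_le_sup E : (H E <= haus_ratio%:E * hausN supn m E)%E.
Proof.
rewrite -lee_pdivrMl ?haus_ratio_gt0//.
apply: le_trans (hausN_delta_lehausN supn m E (ltr01 : (0 : R) < 1)).
apply: le_hausN_delta => D U Us EU; rewrite lee_pdivrMl ?haus_ratio_gt0//.
pose F j := if j \in D then U j else set0.
apply: (@le_trans _ _ (\sum_(j <oo) H (F j))%E).
  apply: le_trans (hausN_sigma_subadditive m N_ge0 F); apply: hausN_mono => // x /EU[j Dj Ujx].
  by exists j => //; rewrite /F mem_set.
rewrite nneseries_esumT; last by move=> j; exact: hausN_ge0.
rewrite [X in (_ <= _ * X)%E]esum_mkcond.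
apply: (@le_trans _ _ (\esum_(j in [set: nat])
   (haus_ratio%:E * (if j \in D then (diamN supn (U j) ^+ m)%:E else 0)))%E).
  apply: le_esum => j _; rewrite /F; case: ifPn => _.
    rewrite -EFinM mulrC; apply: hausN_sub_cube; first exact: (diamN_ge0 supn_ge0).
    by move=> x y Ux Uy; exact: (le_diamN (Us j)) Ux Uy.
  by rewrite mule0 hausN0.
apply: esum_pZl; first exact/ltW/haus_ratio_gt0.
by move=> j; case: ifP => // _; exact: (diamNX_ge0 m supn_ge0).
Qed.
End one_norm.

Lemma haus_ratio_supn_le1 : haus_ratio supn <= 1.
Proof.
rewrite -lee_fin -(hausN_Qcube supn_norm).
apply: le_trans (hausN_Q_le_delta supn_norm ltr01) _.
apply: le_trans (hausN_delta_diam m supn_ge0 ler01 Qcube_diam) _.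
rewrite lee_fin exprn_ile1//; first exact: (diamN_ge0 supn_ge0).
by apply: diamN_le => // x y; exact: Qcube_diam.
Qed.

Section one_norm2.
Variable N : 'rV[R]_m -> R.
Hypothesis hN : is_norm N.
Let N_ge0 := norm_ge0 hN.
Local Notation H := (hausN N m).
Local Notation Hd := (hausN_delta N m).
Local Notation V := (hausN supn m).

Lemma supn_caratheodory (F : set 'rV[R]_m) :
  (forall x, ~ F x -> exists2 r : R, 0 < r & forall y, F y -> r <= supn (x - y)) ->
  (hausN_om m supn_ge0).-caratheodory F.
Proof.
by apply: metric_caratheodory; [exact: (norm_triangle supn_norm)|exact: hausN_metric].
Qed.

Let sclosure (U : set 'rV[R]_m) :=
  [set x | forall r : R, 0 < r -> exists2 y, U y & supn (x - y) < r].

(* In a large cube B containing the closure U' of U, [V] is additive on U' and its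
   complement, and the N-measure of B is at most [diam U ^ m] plus that of the
   complement; no isodiametric inequality is needed. *)
Lemma haus_ratio_small (U : set 'rV[R]_m) (delta : R) :
  (forall x y, U x -> U y -> N (x - y) <= delta) ->
  ((haus_ratio N)%:E * V U <= (diamN N U ^+ m)%:E)%E.
Proof.
move=> Us; have [->|/set0P[x0 Ux0]] := eqVneq U set0.
  by rewrite (hausN0 m supn_ge0) mule0; exact: diamNX_ge0.
have [c c0 hc] : exists2 c : R, 0 < c & forall x, N x <= c * supn x /\ supn x <= c * N x.
  by case: hN.
set d := diamN N U; have d0 : 0 <= d by exact: diamN_ge0.
have Ud x y : U x -> U y -> N (x - y) <= d by exact: le_diamN Us.
(* The closure has no larger N-diameter, and it is Caratheodory measurable, which [U] need not
   be. *)
pose U' := sclosure U.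
have U'd x y : U' x -> U' y -> N (x - y) <= d.
  move=> U'x U'y; apply/ler_addgt0Pr => e e0.
  have r0 : 0 < e / (2 * c) by rewrite divr_gt0// mulr_gt0.
  have [x' Ux' xx'] := U'x _ r0; have [y' Uy' yy'] := U'y _ r0.
  have -> : x - y = (x - x') + ((x' - y') - (y - y')).
    by rewrite !opprB addrA subrKA addrA subrK.
  apply: (le_trans (norm_triangle hN _ _)).
  have := norm_triangle hN (x' - y') (- (y - y')); rewrite (norm_opp hN).
  have := Ud _ _ Ux' Uy'.
  have := proj1 (hc (x - x')); have := proj1 (hc (y - y')).
  move: xx' yy'; rewrite !ltr_pdivlMr ?mulr_gt0//.
  move: (supn _) (supn _) (N _) (N _) (N _) (N _) => s1 s2 n1 n2 n3 n4.
  by move=> *; nra.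
have U'_cara : (hausN_om m supn_ge0).-caratheodory U'.
  apply: supn_caratheodory => x nU'x.
  have [r r0 hr] : exists2 r : R, 0 < r & forall y, U y -> r <= supn (x - y).
    apply: contrapT => h; apply: nU'x => r r0; apply: contrapT => h2.
    apply: h; exists r => // y Uy; rewrite leNgt; apply/negP => lt; apply: h2.
    by exists y.
  exists (r / 2); first by rewrite divr_gt0.
  move=> y U'y; have [z Uz yz] := U'y (r / 2) (divr_gt0 r0 (ltr0n _ 2)).
  have := hr z Uz; have := norm_triangle supn_norm (x - y) (y - z).
  rewrite addrA subrK; move: yz; move: (supn _) (supn _) (supn _) => *; lra.
(* [c * d] bounds the sup-diameter; adding 1 keeps the side of the cube positive when [d = 0]. *)
have [a Ua] : exists a, U' `<=` box a (a + const_mx (c * d + 1)).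
  apply: bounded_sub_box; first by rewrite addr_ge0// mulr_ge0// ltW.
  move=> x y U'x U'y; apply: (le_trans (proj2 (hc _))).
  by rewrite ler_wpDr// ler_pM2l//; exact: U'd.
set s := c * d + 1 in Ua.
have s0 : 0 < s by rewrite ltr_wpDl// mulr_ge0// ltW.
pose B := affine a s @` Qcube.
have U'B : U' `<=` B by apply: subset_trans Ua _; exact: box_affine.
have VB : (V B <= (s ^+ m)%:E)%E.
  apply: (le_trans (hausN_affine supn_norm a Qcube s0)).
  rewrite (hausN_Qcube supn_norm) -EFinM lee_fin ler_piMr ?haus_ratio_supn_le1//.
  by rewrite exprn_ge0// ltW.
have Vsplit : V B = (V U' + V (B `\` U'))%E.
  have := U'_cara B; rewrite /= (_ : B `&` U' = U')// setIC.
  exact: setIidl.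
(* At scale [e = max d 1] the set [U'] alone is an admissible covering of itself, of cost at most
   [d ^+ m]. The cube loses nothing at so coarse a scale, by [hausN_Q_le_delta]. *)
have lb : ((s ^+ m * haus_ratio N)%:E <= (d ^+ m)%:E + (haus_ratio N)%:E * V (B `\` U'))%E.
  pose e := Num.max d 1.
  have e0 : 0 < e by rewrite lt_max ltr01 orbT.
  have Qe : (Hd (s^-1 * e) Qcube <= (s^-1 ^+ m)%:E * Hd e B)%E.
    have := @hausN_delta_image R _ _ N N m N_ge0 N_ge0 B (affine (- s^-1 *: a) s^-1) (s^-1) e.
    have affK x : affine (- s^-1 *: a) s^-1 (affine a s x) = x.
      rewrite /affine scalerDr scaleNr addKr scalerA mulVf ?gt_eqF//.
      by rewrite scale1r.
    have -> : affine (- s^-1 *: a) s^-1 @` B = Qcube.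
      rewrite /B image_comp (eq_imagel (f' := id)) ?image_id// => x _.
      exact: affK.
    by apply; rewrite ?invr_gt0 ?(ltW e0)// => x y _ _; apply: norm_affine => //; rewrite invr_ge0 ltW.
  have Hde : (H Qcube <= (s^-1 ^+ m)%:E * Hd e B)%E.
    by apply: le_trans Qe; apply: hausN_Q_le_delta => //; rewrite mulr_gt0 ?invr_gt0.
  rewrite EFinM -(hausN_Qcube hN).
  apply: (@le_trans _ _ (Hd e B)).
    by rewrite -lee_pdivlMl ?exprn_gt0// -exprVn.
  pose Hd_om : {outer_measure set 'rV[R]_m -> \bar R} := HB.pack (Hd e)
    (isOuterMeasure.Build R _ (Hd e) (hausN_delta0 m N_ge0 _)
    (hausN_delta_ge0 m N_ge0 _) (@hausN_delta_mono _ _ _ m _)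
    (hausN_delta_sigma_subadditive m N_ge0 _)).
  apply: (@le_trans _ _ (Hd e U' + Hd e (B `\` U'))%E).
    rewrite -[X in (Hd e X <= _)%E](setDUK U'B).
    exact: (outer_measureU2 Hd_om).
  apply: leeD.
    apply: (@le_trans _ _ ((diamN N U' ^+ m)%:E)).
      apply: hausN_delta_diam => //; first exact: ltW.
      by move=> x y U'x U'y; rewrite le_max U'd.
    rewrite lee_fin lerXn2r ?nnegrE ?diamN_ge0//.
    exact: diamN_le.
  apply: (@le_trans _ _ (H (B `\` U'))); first exact: hausN_delta_lehausN.
  by rewrite (hausN_Qcube hN); exact: (hausN_le_sup hN).
have VUV : (V U <= V U')%E.
  apply: hausN_mono => x Ux r r0; exists x => //.
  by rewrite subrr /supn normr0.
apply: (@le_trans _ _ ((haus_ratio N)%:E * V U')%E).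
  by apply: lee_wpmul2l => //; rewrite lee_fin ltW// haus_ratio_gt0.
have V0 E : (0 <= V E)%E by exact: hausN_ge0 m supn_ge0 _.
have VBoo : (V B < +oo)%E by apply: le_lt_trans VB _; rewrite ltry.
have fU' : V U' \is a fin_num.
  by rewrite ge0_fin_numE//; apply: le_lt_trans VBoo; exact: hausN_mono.
have fBU' : V (B `\` U') \is a fin_num.
  rewrite ge0_fin_numE//; apply: le_lt_trans VBoo; apply: hausN_mono.
  exact: subDsetl.
(* The measure of the complement of [U'] cancels between the two bounds on the cube, since [V] of
   the cube is at most [s ^+ m]. *)
rewrite Vsplit in VB; move: lb VB.
rewrite -(fineK fU') -(fineK fBU').
rewrite -!EFinM -!EFinD !lee_fin.
have := haus_ratio_gt0 hN.
move: (fine _) (fine _) (haus_ratio N) (s ^+ m) (d ^+ m) => *; nra.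
Qed.

(** The remaining inequality follows by summing [haus_ratio_small] over an arbitrary covering. *)
Theorem hausN_sup (F : set 'rV[R]_m) : H F = ((haus_ratio N)%:E * V F)%E.
Proof.
apply/eqP; rewrite eq_le hausN_le_sup//=.
apply: le_trans (hausN_delta_lehausN N m F (ltr01 : (0 : R) < 1)).
apply: le_hausN_delta => D U Us FU.
pose G j := if j \in D then U j else set0.
apply: (@le_trans _ _ ((haus_ratio N)%:E * \sum_(j <oo) V (G j))%E).
  apply: lee_wpmul2l; first by rewrite lee_fin ltW// haus_ratio_gt0.
  apply: le_trans (hausN_sigma_subadditive m supn_ge0 G).
  apply: hausN_mono => // x /FU[j Dj Ujx].
  by exists j => //; rewrite /G mem_set.
rewrite -nneseriesZl; last by move=> j _; exact: (hausN_ge0 m supn_ge0).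
rewrite nneseries_esumT; last first.
  by move=> j; rewrite mule_ge0 ?(hausN_ge0 m supn_ge0)// lee_fin ltW// haus_ratio_gt0.
rewrite [leRHS]esum_mkcond; apply: le_esum => j _; rewrite /G; case: ifPn => _.
  exact: haus_ratio_small (Us j).
by rewrite (hausN0 m supn_ge0) mule0.
Qed.

End one_norm2.
End norms.

(** * Euclidean geometry and projections *)

Section dot_theory.
Context (R : realType) (n : nat).
Implicit Types x y z u : 'rV[R]_n.

Lemma dotC x y : dot x y = dot y x.
Proof. by apply: eq_bigr => i _; rewrite mulrC. Qed.

Lemma dotDl x y z : dot (x + y) z = dot x z + dot y z.
Proof. by rewrite /dot -big_split; apply: eq_bigr => i _; rewrite mxE mulrDl. Qed.

Lemma dotZl a x z : dot (a *: x) z = a * dot x z.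
Proof. by rewrite /dot mulr_sumr; apply: eq_bigr => i _; rewrite mxE mulrA. Qed.

Lemma dotNl x z : dot (- x) z = - dot x z.
Proof. by rewrite -scaleN1r dotZl mulN1r. Qed.

Lemma dotBl x y z : dot (x - y) z = dot x z - dot y z.
Proof. by rewrite dotDl dotNl. Qed.

Lemma dotDr x y z : dot z (x + y) = dot z x + dot z y.
Proof. by rewrite ![dot z _]dotC dotDl. Qed.

Lemma dotZr a x z : dot z (a *: x) = a * dot z x.
Proof. by rewrite ![dot z _]dotC dotZl. Qed.

Lemma dotBr x y z : dot z (x - y) = dot z x - dot z y.
Proof. by rewrite ![dot z _]dotC dotBl. Qed.

Lemma dot0l x : dot 0 x = 0.
Proof. by rewrite -(scale0r 0) dotZl mul0r. Qed.

Lemma dotxx_ge0 x : 0 <= dot x x.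
Proof. by apply: sumr_ge0 => i _; rewrite -expr2 sqr_ge0. Qed.

Lemma dotxx_eq0 x : dot x x = 0 -> x = 0.
Proof.
move=> /eqP; rewrite psumr_eq0 => [/allP h|i _]; last by rewrite -expr2 sqr_ge0.
apply/rowP => i; have := h i (mem_index_enum _); rewrite mulf_eq0 orbb => /eqP.
by rewrite mxE.
Qed.

Lemma enorm_ge0 x : 0 <= enorm x. Proof. exact: sqrtr_ge0. Qed.

Lemma sqr_enorm x : enorm x ^+ 2 = dot x x.
Proof. by rewrite sqr_sqrtr ?dotxx_ge0. Qed.

Lemma enorm0 : enorm (0 : 'rV[R]_n) = 0.
Proof. by rewrite /enorm dot0l sqrtr0. Qed.

Lemma enormZ a x : enorm (a *: x) = `|a| * enorm x.
Proof. by rewrite /enorm dotZl dotZr mulrA -expr2 sqrtrM ?sqr_ge0// sqrtr_sqr. Qed.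

Lemma enormN x : enorm (- x) = enorm x.
Proof. by rewrite -scaleN1r enormZ normrN1 mul1r. Qed.

Lemma enorm_gt0 x : x != 0 -> 0 < enorm x.
Proof.
move=> x0; rewrite sqrtr_gt0 lt_neqAle dotxx_ge0 andbT eq_sym.
by apply: contra x0 => /eqP/dotxx_eq0/eqP.
Qed.

Lemma cauchy_schwarz x y : `|dot x y| <= enorm x * enorm y.
Proof.
have sq : dot x y ^+ 2 <= dot x x * dot y y.
  have [y0|y0] := eqVneq (dot y y) 0.
    by rewrite y0 mulr0 (dotxx_eq0 y0) dotC dot0l expr0n.
  have ypos : 0 < dot y y by rewrite lt_neqAle eq_sym y0 dotxx_ge0.
  have := dotxx_ge0 (dot y y *: x - dot x y *: y).
  rewrite !dotBl !dotBr !dotZl !dotZr (dotC y x).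
  move: (dot x x) (dot x y) (dot y y) ypos => a b c c0 h.
  have : 0 <= c * (a * c - b ^+ 2) by rewrite (le_trans h)// le_eqVlt; apply/orP; left; apply/eqP; ring.
  by rewrite pmulr_rge0// subr_ge0.
rewrite -(ler_pXn2r (ltn0Sn 1)) ?nnegrE ?mulr_ge0 ?enorm_ge0//.
by rewrite exprMn !sqr_enorm real_normK ?num_real.
Qed.

Lemma dot_le x y : dot x y <= enorm x * enorm y.
Proof. exact: le_trans (ler_norm _) (cauchy_schwarz _ _). Qed.

Lemma dot_ge x y : - (enorm x * enorm y) <= dot x y.
Proof. by rewrite lerNl -dotNl -(enormN x); exact: dot_le. Qed.

Lemma enorm_triangle x y : enorm (x + y) <= enorm x + enorm y.
Proof.
rewrite -(ler_pXn2r (ltn0Sn 1)) ?nnegrE ?addr_ge0 ?enorm_ge0//.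
rewrite sqr_enorm dotDl !dotDr (dotC y x) sqrrD !sqr_enorm.
have := dot_le x y; move: (dot _ _) (dot _ _) (dot _ _) (enorm _ * _) => *; lra.
Qed.

Lemma enormB_sym x y : enorm (x - y) = enorm (y - x).
Proof. by rewrite -enormN opprB. Qed.

Lemma supn_le_enorm x : supn x <= enorm x.
Proof.
apply/supn_le => [|i]; first exact: enorm_ge0.
rewrite -(ler_pXn2r (ltn0Sn 1)) ?nnegrE ?enorm_ge0// real_normK ?num_real// sqr_enorm.
rewrite /dot (bigD1 i)//= -expr2 lerDl sumr_ge0// => j _.
by rewrite -expr2 sqr_ge0.
Qed.

Lemma enorm_le_supn x : enorm x <= n.+1%:R * supn x.
Proof.
have s0 := supn_ge0 x.
rewrite -(ler_pXn2r (ltn0Sn 1)) ?nnegrE ?mulr_ge0 ?enorm_ge0// sqr_enorm exprMn.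
apply: (@le_trans _ _ (\sum_(i < n) supn x ^+ 2)).
  apply: ler_sum => i _; rewrite -expr2 -[X in X <= _]real_normK ?num_real//.
  by rewrite lerXn2r ?nnegrE//; exact: coord_le_supn.
rewrite sumr_const card_ord -[_ *+ n]mulr_natl ler_wpM2r ?sqr_ge0// -natrX ler_nat.
by rewrite (leq_trans (leqnSn n))// leq_pmulr.
Qed.

End dot_theory.

Section projection.
Context (R : realType) (m : nat).
Local Notation E := 'rV[R]_m.+1.
Local Notation F := 'rV[R]_m.

(** A linear map whose kernel is the line of [e], with a linear section. It is oblique, so that its
    values are plain coordinates in R^m and no orthonormal basis of a hyperplane has to be
    chosen. *)
Record projection_along (e : E) (P : E -> F) (J : F -> E) : Prop := {
  prjB : forall x y, P (x - y) = P x - P y ;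
  prjZ : forall a x, P (a *: x) = a *: P x ;
  secB : forall x y, J (x - y) = J x - J y ;
  secZ : forall a x, J (a *: x) = a *: J x ;
  prjK : forall y, P (J y) = y ;
  proj_e : P e = 0 ;
  proj_dec : forall x, exists s, x = J (P x) + s *: e ;
  proj_bound : exists2 c, 0 < c & forall x, supn (P x) <= c * enorm x ;
  sec_bound : exists2 c, 0 < c & forall y, enorm (J y) <= c * supn y }.

(** A coordinate where [e] does not vanish is cleared by subtracting a multiple of [e] and then
    dropped; the section puts 0 back. *)
Lemma exists_projection (e : E) : e != 0 -> exists P J, projection_along e P J.
Proof.
move=> e0.
have [i0 ei0] : exists i0, e ord0 i0 != 0.
  apply/existsP; apply: contraR e0 => /existsPn h; apply/eqP/rowP => i.
  by have := h i; rewrite negbK mxE => /eqP.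
pose P (x : E) : F := \row_j (x ord0 (lift i0 j) - x ord0 i0 / e ord0 i0 * e ord0 (lift i0 j)).
pose J (y : F) : E := \row_i (if unlift i0 i is Some j then y ord0 j else 0).
exists P, J; split.
- by move=> x y; apply/rowP => j; rewrite !mxE; ring.
- by move=> a x; apply/rowP => j; rewrite !mxE; ring.
- by move=> x y; apply/rowP => i; rewrite !mxE; case: unliftP => [j _|_]; rewrite ?mxE ?subrr.
- by move=> a x; apply/rowP => i; rewrite !mxE; case: unliftP => [j _|_]; rewrite ?mxE ?mulr0.
- by move=> y; apply/rowP => j; rewrite !mxE liftK unlift_none mul0r mul0r subr0.
- by apply/rowP => j; rewrite !mxE divff// mul1r subrr.
- move=> x; exists (x ord0 i0 / e ord0 i0); apply/rowP => i; rewrite !mxE.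
  case: unliftP => [j ->|->]; first by rewrite mxE subrK.
  by rewrite add0r divfK.
- exists (1 + `|(e ord0 i0)^-1| * enorm e) => [|x].
    by rewrite ltr_pwDl// mulr_ge0// enorm_ge0.
  have c0 : 0 <= (1 + `|(e ord0 i0)^-1| * enorm e) * enorm x.
    by rewrite mulr_ge0 ?enorm_ge0// addr_ge0// mulr_ge0// enorm_ge0.
  apply/(supn_le _ c0) => j; rewrite mxE; apply: (le_trans (ler_normB _ _)).
  rewrite mulrDl mul1r; apply: lerD.
    exact: le_trans (coord_le_supn _ _) (supn_le_enorm _).
  rewrite !normrM [`|x _ _| * _]mulrC -!mulrA; apply: ler_wpM2l => //.
  rewrite [leRHS]mulrC.
  by apply: ler_pM => //; exact: le_trans (coord_le_supn _ _) (supn_le_enorm _).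
- exists m.+2%:R => // y; apply: (le_trans (enorm_le_supn _)).
  rewrite ler_wpM2l//; apply/(supn_le _ (supn_ge0 y)) => i; rewrite mxE.
  by case: unliftP => [j _|_]; rewrite ?normr0 ?supn_ge0// coord_le_supn.
Qed.

End projection.

(** * Projections of almost flat sets *)

(** Turns a tolerated factor [K] on measures into a Lipschitz constant, which enters measures with
    exponent [m]. *)
Lemma exists_root_gt1 (R : realType) (m : nat) (K : R) : 1 < K ->
  exists2 L : R, 1 < L & L ^+ m <= K.
Proof.
elim: m K => [|m ih] K K1; first by exists K => //; rewrite expr0 ltW.
have s1 : 1 < Num.sqrt K by rewrite -[X in X < _]sqrtr1 ltr_sqrt// (lt_trans ltr01).
have [L L1 LK] := ih _ s1.
exists (Num.min L (Num.sqrt K)); first by rewrite lt_min L1.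
have m0 : 0 <= Num.min L (Num.sqrt K) by rewrite le_min !ltW// (lt_trans ltr01).
rewrite exprS -[leRHS]sqr_sqrtr ?(ltW (lt_trans ltr01 K1))// expr2.
apply: ler_pM => //; first exact: exprn_ge0.
  by rewrite ge_min lexx orbT.
apply: le_trans LK; apply: lerXn2r; rewrite ?nnegrE ?(ltW (lt_trans ltr01 L1))//.
by rewrite ge_min lexx.
Qed.

Section flat.
Context (R : realType) (m : nat).
Local Notation E := 'rV[R]_m.+1.
Local Notation F := 'rV[R]_m.
Local Notation H := (hausN (@enorm R m.+1) m).
Local Notation V := (hausN (@supn R m) m).
Variables (e : E) (P : E -> F) (J : F -> E).
Hypothesis hP : projection_along e P J.

(* The section of P whose image is the hyperplane orthogonal to u. *)
Definition sect (u : E) (y : F) : E := J y - (dot (J y) u / dot e u) *: e.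

(** The Euclidean norm of the hyperplane orthogonal to [u], read in the coordinates given by [P]. *)
Definition sect_norm (u : E) (y : F) : R := enorm (sect u y).

Lemma sect_proj u x : dot e u != 0 -> sect u (P x) = x - (dot x u / dot e u) *: e.
Proof.
move=> eu; have [s xE] := proj_dec hP x.
rewrite /sect; move: (J (P x)) xE => y ->.
rewrite dotDl dotZl mulrDl mulfK// scalerDl opprD addrACA subrr addr0.
by [].
Qed.

Lemma secD x y : J (x + y) = J x + J y.
Proof.
have J0 : J 0 = 0 by rewrite -(subrr x) (secB hP) subrr.
by rewrite -{1}[y]opprK (secB hP) -{1}[- y]add0r (secB hP) J0 sub0r opprK.
Qed.

Lemma sectD u x y : sect u (x + y) = sect u x + sect u y.
Proof.
by rewrite /sect secD dotDl mulrDl scalerDl opprD addrACA.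
Qed.

Lemma sectZ u a x : sect u (a *: x) = a *: sect u x.
Proof. by rewrite /sect (secZ hP) dotZl scalerBr scalerA mulrA. Qed.

Lemma sectK u y : P (sect u y) = y.
Proof. by rewrite /sect (prjB hP) (prjZ hP) (proj_e hP) scaler0 subr0 (prjK hP). Qed.

Lemma sect_norm_norm u : is_norm (sect_norm u).
Proof.
split.
- by move=> x; exact: enorm_ge0.
- by move=> x; rewrite /sect_norm -scaleN1r sectZ scaleN1r enormN.
- by move=> x y; rewrite /sect_norm sectD enorm_triangle.
- by move=> t x; rewrite /sect_norm sectZ enormZ.
have [c c0 hc] := proj_bound hP; have [d d0 hd] := sec_bound hP.
pose k := d + d * enorm u / `|dot e u| * enorm e.
have k0 : 0 < k.
  rewrite ltr_pwDl// mulr_ge0 ?enorm_ge0// divr_ge0// mulr_ge0 ?enorm_ge0//.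
  exact: ltW.
exists (k + c) => [|x]; first exact: addr_gt0.
split.
  apply: (@le_trans _ _ (k * supn x)); last by rewrite ler_wpM2r ?supn_ge0// lerDl ltW.
  apply: (le_trans (enorm_triangle _ _)); rewrite enormN enormZ /k mulrDl.
  apply: lerD => //.
  rewrite [leRHS]mulrAC; apply: ler_wpM2r; first exact: enorm_ge0.
  rewrite normrM normfV [leRHS]mulrAC; apply: ler_wpM2r; first by rewrite invr_ge0.
  apply: (le_trans (cauchy_schwarz _ _)).
  by rewrite mulrAC; apply: ler_wpM2r; [exact: enorm_ge0|exact: hd].
rewrite -{1}(sectK u x); apply: (le_trans (hc _)).
by rewrite /sect_norm ler_wpM2r ?enorm_ge0// lerDr ltW.
Qed.

(** Plays the role of the inverse Jacobian of the projection along [e] restricted to the hyperplane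
    orthogonal to [u], up to normalization. *)
Definition sect_ratio u : R := haus_ratio (sect_norm u).

Lemma sect_ratio_gt0 u : 0 < sect_ratio u. Proof. exact: haus_ratio_gt0 (sect_norm_norm u). Qed.

Definition flat (u : E) (theta : R) (A : set E) :=
  forall x y, A x -> A y -> `|dot (x - y) u| <= theta * enorm (x - y).

(** On a flat set, sliding points along [e] into the hyperplane orthogonal to [u] changes
    differences [x - y] by a small fraction of their length. It is thus bi-Lipschitz with a constant
    [L] such that [L ^+ m <= K], and [hausN_sup] evaluates the measure of the image. *)
Lemma flat_compare (u : E) (K : R) : e != 0 -> dot e u != 0 -> 1 < K ->
  exists2 theta : R, 0 < theta & forall A, flat u theta A ->
    (H A <= K%:E * ((sect_ratio u)%:E * V (P @` A)) /\
     (sect_ratio u)%:E * V (P @` A) <= K%:E * H A)%E.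
Proof.
move=> e0 eu K1; have [L L1 LK] := exists_root_gt1 m K1.
have L0 : 0 < L := lt_trans ltr01 L1.
have Ve : 0 < enorm e := enorm_gt0 e0.
have aeu : 0 < `|dot e u| by rewrite normr_gt0.
(* Distances change by a factor between [1 - d], which is 1/L, and [1 + d], which is at most [L]
   because L + 1/L >= 2. *)
pose d := 1 - L^-1.
have d0 : 0 < d by rewrite subr_gt0 invf_lt1.
exists (d * `|dot e u| / enorm e); first by rewrite divr_gt0 ?mulr_gt0.
move=> A flatA.
have corr x y : A x -> A y -> enorm ((dot (x - y) u / dot e u) *: e) <= d * enorm (x - y).
  move=> Ax Ay; rewrite enormZ normrM normfV.
  rewrite -ler_pdivlMr// ler_pdivrMr//.
  apply: (le_trans (flatA x y Ax Ay)).
  by rewrite le_eqVlt; apply/orP; left; apply/eqP; ring.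
rewrite -(hausN_sup (sect_norm_norm u)) .
have K0 : 0 <= K by rewrite ltW// (lt_trans ltr01).
have dotP x y : sect_norm u (P x - P y) = enorm (x - y - (dot (x - y) u / dot e u) *: e).
  by rewrite -(prjB hP) /sect_norm sect_proj.
split.
  apply: (@le_trans _ _ ((L ^+ m)%:E * hausN (sect_norm u) m (P @` A))%E); last first.
    by apply: lee_wpmul2r; rewrite ?lee_fin// hausN_ge0// => y; exact: enorm_ge0.
  apply: hausN_preimage => //; try by move=> ?; exact: enorm_ge0.
  move=> x y Ax Ay; rewrite dotP.
  have := enorm_triangle (x - y - (dot (x - y) u / dot e u) *: e) ((dot (x - y) u / dot e u) *: e).
  rewrite subrK; have := corr x y Ax Ay.
  have -> : d * enorm (x - y) = enorm (x - y) - L^-1 * enorm (x - y) by rewrite /d mulrBl mul1r.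
  rewrite -ler_pdivrMl//.
  move: (enorm (x - y)) (enorm _) (enorm _) => a b c; move: (L^-1 * a) => *; lra.
apply: (@le_trans _ _ ((L ^+ m)%:E * H A)%E); last first.
  by apply: lee_wpmul2r; rewrite ?lee_fin// hausN_ge0// => y; exact: enorm_ge0.
apply: hausN_image => //; try by move=> ?; exact: enorm_ge0.
move=> x y Ax Ay; rewrite dotP.
apply: (le_trans (enorm_triangle _ _)); rewrite enormN.
have := corr x y Ax Ay; rewrite /d.
have : 2 <= L + L^-1.
  have L2 : L * L^-1 = 1 by rewrite divff ?gt_eqF.
  have : 0 < L^-1 by rewrite invr_gt0.
  have := sqr_ge0 (L - 1).
  by move: (L^-1) L2 => M *; nra.
have := enorm_ge0 (x - y).
move: (L^-1) (enorm _) (enorm _) => *; nra.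
Qed.

End flat.

(** * Translation, dilation and positivity for the sup-norm measure *)

Section sup_measure.
Context (R : realType) (m : nat).
Local Notation V := (hausN (@supn R m) m).

Lemma hausN_supn_translate (a : 'rV[R]_m) E : (V E <= V ((fun x => (x + a)%R) @` E))%E.
Proof.
have := @hausN_preimage R _ _ (@supn R m) (@supn R m) m (@supn_ge0 R m) (@supn_ge0 R m) E (fun x => x + a) 1 ltr01.
by rewrite expr1n mul1e; apply => x y _ _; rewrite mul1r opprD addrACA subrr addr0.
Qed.

Lemma hausN_supn_dilate (l : R) E : 0 < l -> ((l ^+ m)%:E * V E <= V ((fun x => l *: x) @` E))%E.
Proof.
move=> l0.
have := @hausN_preimage R _ _ (@supn R m) (@supn R m) m (@supn_ge0 R m) (@supn_ge0 R m) E (fun x => l *: x) l^-1.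
rewrite invr_gt0 => /(_ l0) h.
rewrite -lee_pdivlMl ?exprn_gt0// -exprVn; apply: h => x y _ _.
by rewrite -scalerBr /supn normrZ gtr0_norm// mulrA mulVf ?gt_eqF// mul1r.
Qed.

Lemma hausN_supn_bounded (E : set 'rV[R]_m) (c : R) :
  (forall x y, E x -> E y -> supn (x - y) <= c) -> (V E < +oo)%E.
Proof.
move=> Ec; have [->|/set0P[x Ex]] := eqVneq E set0.
  by rewrite (hausN0 m (@supn_ge0 R m)) ltry.
have c0 : 0 <= c by apply: le_trans (Ec x x Ex Ex); exact: supn_ge0.
exact: le_lt_trans (hausN_sub_cube (@supn_norm R m) c0 Ec) (ltry _).
Qed.

Lemma hausN_supn_gt0 (a : 'rV[R]_m) (s : R) (E : set 'rV[R]_m) : 0 < s ->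
  (forall x, supn x <= s -> E (x + a)) -> (0 < V E)%E.
Proof.
move=> s0 hE.
have V1 : (0 < V [set x | supn x <= s]%R)%E.
  apply: lt_le_trans (volume_le_hausN _).
  apply: (@lt_le_trans _ _ (s ^+ m)%:E); first by rewrite lte_fin exprn_gt0.
  apply: volume_cube_ge; first exact: ltW.
  move=> x hx; apply/(supn_le x (ltW s0)) => i.
  by have /andP[x0 x1] := hx i; rewrite ger0_norm.
apply: (lt_le_trans V1); apply: (le_trans (hausN_supn_translate a _)).
by apply: hausN_mono => // _ [x hx <-]; exact: hE.
Qed.

End sup_measure.

(** * Boundary points with a normal in a given set *)

(** Compactness as an induction principle: if [I A] failed, the sets [B] such that [I] holds of [A]
    minus [B] would form a proper filter containing [A], and the local hypothesis at a cluster point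
    would contradict it. *)
Lemma compact_ideal (T : topologicalType) (A : set T) (I : set T -> Prop) :
  compact A -> I set0 -> (forall B C, B `<=` C -> I C -> I B) ->
  (forall B C, I B -> I C -> I (B `|` C)) ->
  (forall x, A x -> exists2 U, nbhs x U & I (U `&` A)) -> I A.
Proof.
move=> cA I0 Isub IU Iloc; apply: contrapT => nIA.
pose F : set_system T := [set B | I (A `\` B)].
have FF : ProperFilter F.
  split; first by rewrite /F /= setD0.
  split.
  - by rewrite /F /= setDT.
  - by move=> B C FB FC; rewrite /F /= setDIr; exact: IU.
  - by move=> B C BC; apply: Isub; exact: setDS.
have FA : F A by rewrite /F /= setDv.
have [x [Ax xF]] := cA F FF FA.
have [U Ux IUA] := Iloc x Ax.
have FcU : F (~` U) by rewrite /F /= setDE setCK setIC.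
by have [y [nUy Uy]] := xF _ _ FcU Ux.
Qed.

Section topology.
Context (R : realType) (n : nat).
Implicit Types (x y : 'rV[R]_n) (A : set 'rV[R]_n).

Lemma nbhs_enorm x A :
  nbhs x A <-> exists2 r : R, 0 < r & forall y, enorm (y - x) < r -> A y.
Proof.
split.
  move=> /nbhs_ballP[r /= r0 hr]; exists r => // y yx; apply: hr.
  rewrite -ball_normE /= distrC; apply: le_lt_trans yx; exact: supn_le_enorm.
move=> [r r0 hr]; apply/nbhs_ballP; exists (r / n.+1%:R); first exact: divr_gt0.
move=> y; rewrite -ball_normE /= distrC ltr_pdivlMr// mulrC => yx; apply: hr.
apply: le_lt_trans yx; exact: enorm_le_supn.
Qed.

Lemma closed_enorm A : closed A <->
  (forall x, ~ A x -> exists2 r : R, 0 < r & forall y, A y -> r <= enorm (x - y)).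
Proof.
rewrite -openC openE; split => [h x nAx|h x nAx].
  have /nbhs_enorm[r r0 hr] := h x nAx.
  exists r => // y Ay; rewrite leNgt; apply/negP; rewrite enormB_sym => /hr.
  by apply.
apply/nbhs_enorm; have [r r0 hr] := h x nAx; exists r => // y yx Ay.
by have := hr y Ay; rewrite enormB_sym leNgt yx.
Qed.

Lemma compact_uniform (W : set 'rV[R]_n) (Q : R -> 'rV[R]_n -> Prop) :
  compact W ->
  (forall r s v, 0 < s -> s <= r -> Q r v -> Q s v) ->
  (forall u, W u -> exists2 r : R, 0 < r & forall v, W v -> enorm (v - u) < r -> Q r v) ->
  exists2 r : R, 0 < r & forall v, W v -> Q r v.
Proof.
move=> cW Qanti loc.
apply: (compact_ideal (I := fun B => exists2 r : R, 0 < r & forall v, B v -> Q r v) cW).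
- by exists 1.
- by move=> B C BC [r r0 hr]; exists r => // v /BC; exact: hr.
- move=> B C [r r0 hr] [s s0 hs]; have rs0 : 0 < Num.min r s by rewrite lt_min r0.
  exists (Num.min r s) => // v [/hr|/hs]; apply: Qanti => //; rewrite ge_min lexx ?orbT//.
- move=> u Wu; have [r r0 hr] := loc u Wu.
  exists [set v | enorm (v - u) < r]; first by apply/nbhs_enorm; exists r.
  by exists r => // v [? ?]; exact: hr.
Qed.

End topology.

(** * Support functions and contact points in the cone *)

Section cone.
Context (R : realType) (m : nat).
Local Notation E := 'rV[R]_m.+1.
Variables (C omega : set E).
Hypothesis hC : pointed_closed_convex_cone C.
Hypothesis omega_compact : compact omega.
Hypothesis omegaC : omega `<=` Omega C.

Lemma coneZ x (l : R) : C x -> 0 <= l -> C (l *: x).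
Proof. by case: hC => _ _ h _; exact: h. Qed.

Lemma coneD x y : C x -> C y -> C (x + y).
Proof.
case: hC => _ cC _ _ Cx Cy.
have h0 : 0 <= 2^-1 :> R by rewrite invr_ge0.
have h1 : 2^-1 <= 1 :> R by rewrite invf_le1// ler1n.
have Cx2 : 2 *: x \in C by rewrite inE; exact: coneZ.
have Cy2 : 2 *: y \in C by rewrite inE; exact: coneZ.
have := cC (2 *: x) (2 *: y) (Itv01 h0 h1) Cx2 Cy2.
rewrite inE /conv /= !scalerA (_ : unstable.onem 2^-1 = 2^-1 :> R); last by rewrite /unstable.onem; field.
by rewrite mulVf// !scale1r.
Qed.

Lemma cone0 : C 0.
Proof. by case: hC => _ _ _ h; have : [set 0] (0 : E) by []; rewrite -h => -[]. Qed.

Lemma int_coneD x y : C° x -> C y -> C° (x + y).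
Proof.
move=> /nbhs_enorm[r r0 hr] Cy; apply/nbhs_enorm; exists r => // z hz.
rewrite -(subrK y z); apply: coneD => //; apply: hr.
by rewrite -addrA -opprD (addrC y).
Qed.

Lemma int_coneZ x (l : R) : C° x -> 0 < l -> C° (l *: x).
Proof.
move=> /nbhs_enorm[r r0 hr] l0; apply/nbhs_enorm; exists (l * r); first exact: mulr_gt0.
move=> z hz; rewrite -(scale1r z) -(mulfV (lt0r_neq0 l0)) -scalerA; apply: coneZ; last exact: ltW.
apply: hr; rewrite -(ltr_pM2l l0); apply: le_lt_trans hz.
rewrite -{1}(gtr0_norm l0) -enormZ scalerBr scalerA divff ?gt_eqF// scale1r.
exact: lexx.
Qed.

Lemma omega_enorm u : omega u -> enorm u = 1.
Proof. by move=> /omegaC[]. Qed.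

Lemma cone_strict : exists2 c : R, 0 < c &
  forall u y, omega u -> C y -> dot y u <= - (c * enorm y).
Proof.
have [||c c0 hc] := @compact_uniform R _ omega
   (fun r u => forall y, C y -> dot y u <= - (r * enorm y)) omega_compact; last first.
- by exists c => // u y /hc; exact.
- move=> u /omegaC[_ /nbhs_enorm[r r0 hr]]; exists (r / 2); first exact: divr_gt0.
  move=> v _ vu y Cy; have [->|y0] := eqVneq y 0; first by rewrite dot0l enorm0 mulr0 oppr0.
  have ey := enorm_gt0 y0.
  (* The vector [v], within [r / 2] of [u], is tilted by [r / 2] in the direction of [y] itself; it
     still lies in the polar cone. *)
  have := hr (v + (r / 2 / enorm y) *: y) _ y Cy; rewrite dotDl dotZl -sqr_enorm.
  rewrite expr2 mulrA divfK ?gt_eqF// (dotC v) => h.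
  rewrite lerNr -subr_le0 opprK addrC; apply: h.
  rewrite addrAC; apply: (le_lt_trans (enorm_triangle _ _)).
  rewrite enormZ ger0_norm; last by rewrite !divr_ge0 ?ltW.
  by rewrite divfK ?gt_eqF// [ltRHS](splitr r) ltrD2r.
- move=> r s v s0 sr h y Cy; apply: (le_trans (h y Cy)).
  by rewrite lerN2 ler_wpM2r ?enorm_ge0.
Qed.

(** What the comparison uses of [C] minus [A] and its support function: [pc_det] says that [omega]
    determines the set, [pc_neg] that the origin stays away from it, and [pc_lip] makes compactness
    arguments over [omega] possible. *)
Record pseudocone (K : set E) (h : E -> R) : Prop := {
  pc_sub : K `<=` C ;
  pc_closed : closed K ;
  pc_le : forall u x, omega u -> K x -> dot x u <= h u ;
  pc_det : forall x, C x -> (forall u, omega u -> dot x u <= h u) -> K x ;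
  pc_lip : exists2 L, 0 < L &
    forall u v, omega u -> omega v -> h u <= h v + L * enorm (u - v) ;
  pc_neg : forall u, omega u -> h u < 0 ;
  pc_sup : forall u (eps : R), omega u -> 0 < eps -> exists2 x, K x & h u - eps < dot x u }.

Definition contact (K : set E) (h : E -> R) (eta : set E) : set E :=
  [set x | [/\ C° x, K x & exists2 u, eta u & dot x u = h u]].

Lemma determined_pseudocone (K : set E) : omega !=set0 -> determined C omega K ->
  K <> C -> pseudocone K (support_function K).
Proof.
move=> [u0 wu0] [clK cvK KC KE] KnC.
set h := support_function K.
have [c c0 hc] := cone_strict.
have K0 : K !=set0.
  (* For empty [K] the default [sup set0 = 0] gives half-spaces through the origin, so [KE] would
     put 0 into [K]. *)
  apply/set0P/eqP => K0; have : K 0; last by rewrite K0.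
  rewrite KE; split; first exact: cone0.
  by move=> u wu; rewrite /halfspace /= K0 /support_function image_set0 sup0 dot0l.
have hs u : omega u -> has_sup [set dot u y | y in K].
  move=> wu; split; first by have [y Ky] := K0; exists (dot u y), y.
  exists 0 => _ [y Ky <-]; rewrite dotC; apply: (le_trans (hc u y wu (KC y Ky))).
  by rewrite oppr_le0 mulr_ge0 ?enorm_ge0// ltW.
have hle u x : omega u -> K x -> dot x u <= h u.
  by move=> wu Kx; rewrite dotC; apply: sup_upper_bound; [exact: hs|exists x].
have hsup u (eps : R) : omega u -> 0 < eps -> exists2 x, K x & h u - eps < dot x u.
  move=> wu e0; have [_ [x Kx <-] lt] := sup_adherent e0 (hs u wu).
  by exists x => //; rewrite dotC.
have hdet x : C x -> (forall u, omega u -> dot x u <= h u) -> K x.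
  by move=> Cx hx; rewrite KE; split.
split => //.
- have [y0 Ky0] := K0.
  pose L := enorm y0 / c + 1.
  have L0 : 0 < L by rewrite ltr_wpDl// divr_ge0 ?enorm_ge0// ltW.
  exists L => // u v wu wv; apply: ge_sup.
    by exists (dot u y0), y0.
  move=> _ [y Ky <-]; rewrite dotC.
  (* Far points are harmless: beyond norm |y0|/c, [dot y u] is below -|y0|, hence below [dot y0 v]
     and [h v]. Only a bounded part of [K] enters the Lipschitz constant. *)
  have [yL|yL] := leP (enorm y) (enorm y0 / c).
    have -> : u = v + (u - v) by rewrite addrC subrK.
    rewrite dotDr; apply: lerD; first exact: hle.
    rewrite [v + _]addrC subrK; apply: (le_trans (dot_le _ _)).
    by apply: ler_wpM2r; [exact: enorm_ge0|rewrite (le_trans yL)// lerDl].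
  apply: (le_trans (hc u y wu (KC y Ky))).
  apply: (@le_trans _ _ (h v)); last by rewrite lerDl mulr_ge0 ?enorm_ge0// ltW.
  apply: le_trans (hle v y0 wv Ky0).
  apply: le_trans (dot_ge _ _); rewrite lerN2 (omega_enorm wv) mulr1.
  by move: yL; rewrite ltr_pdivrMr// mulrC => /ltW.
- move=> u wu; rewrite ltNge; apply/negP => hu.
  (* If [h u >= 0], points of [K] almost attaining the supremum are arbitrarily short by
     [cone_strict], so the origin is in [K]. Every constraint then holds on all of [C], and
     [K = C]. *)
  have K00 : K 0.
    apply: contrapT => nK0; have [r r0 hr] := (closed_enorm K).1 clK 0 nK0.
    have [x Kx lt] := hsup u (c * r) wu (mulr_gt0 c0 r0).
    have := hr x Kx; rewrite sub0r enormN leNgt => /negP; apply.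
    rewrite -(ltr_pM2l c0).
    have := hc u x wu (KC x Kx); lra.
  apply: KnC; apply/seteqP; split => // x Cx; apply: hdet => // v wv.
  apply: (@le_trans _ _ 0).
    by apply: (le_trans (hc v x wv Cx)); rewrite oppr_le0 mulr_ge0 ?enorm_ge0// ltW.
  by have := hle v 0 wv K00; rewrite dot0l.
Qed.

(** A normal direction is one whose support value is attained. Conversely such a point is not
    interior, as a step along [u] would exceed [h u]. *)
Lemma reverse_gauss_contact K h eta : pseudocone K h -> eta `<=` omega ->
  reverse_gauss C K eta = contact K h eta.
Proof.
move=> hK etaw; apply/seteqP; split => x.
  move=> [[[clx _] Cx] [u eu [_ ux]]]; split => //; first exact: (pc_closed hK).
  have Kx : K x by exact: (pc_closed hK).
  exists u => //; apply/eqP; rewrite eq_le (pc_le hK)//=; last exact: etaw.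
  apply/ler_addgt0Pr => eps e0; have [y Ky lt] := pc_sup hK (etaw _ eu) e0.
  have := ux y Ky; rewrite dotBl; lra.
move=> [Cx Kx [u eu xu]].
have u1 : enorm u = 1 by exact: omega_enorm (etaw _ eu).
split; last first.
  exists u => //; split => // y Ky; rewrite dotBl subr_le0 xu.
  by apply: (pc_le hK) => //; exact: etaw.
split => //; split; first exact: subset_closure.
move=> /nbhs_enorm[r r0 hr].
have := hr (x + (r / 2) *: u); rewrite addrAC subrr add0r enormZ u1 mulr1.
rewrite gtr0_norm ?divr_gt0// ltr_pdivrMr// ltr_pMr// ltr1n => /(_ isT) Ky.
have := pc_le hK (etaw _ eu) Ky; rewrite dotDl dotZl xu -sqr_enorm u1 expr1n mulr1.
by rewrite gerDl leNgt divr_gt0.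
Qed.

(** The point moves by the least [t] for which all constraints hold. One of them is then tight:
    otherwise compactness of [omega] would give a uniform margin and [t] could be decreased. *)
Lemma push_contact K h (e x u : E) : pseudocone K h -> C e -> e != 0 ->
  C° x -> omega u -> h u < dot x u ->
  exists t : R, exists2 v, omega v & contact K h [set v] (x + t *: e) /\ h v < dot x v.
Proof.
move=> hK Ce e0 Cx wu hux.
have [c c0 hc] := cone_strict; have ee := enorm_gt0 e0.
have [L L0 hL] := pc_lip hK.
have eneg v : omega v -> dot e v < 0.
  move=> wv; apply: (le_lt_trans (hc v e wv Ce)); rewrite oppr_lt0; exact: mulr_gt0.
pose S := [set t : R | 0 <= t /\ forall v, omega v -> dot x v + t * dot e v <= h v].
have S0 : S !=set0.
  (* Unit vectors are at distance at most 2, so [h u <= h v + 2 * L]: this shift lowers [dot x v] by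
     at least [2 * L - h u], which is at least [- h v]. *)
  exists ((2 * L - h u) / (c * enorm e)).
  have t0 : 0 <= (2 * L - h u) / (c * enorm e).
    rewrite divr_ge0 ?mulr_ge0 ?(ltW c0) ?enorm_ge0//.
    have := pc_neg hK wu; lra.
  split => // v wv.
  have xv : dot x v <= 0.
    apply: (le_trans (hc v x wv (interior_subset Cx))).
    by rewrite oppr_le0 mulr_ge0 ?enorm_ge0// ltW.
  have := ler_wpM2l t0 (hc v e wv Ce); rewrite mulrN divfK; last by rewrite gt_eqF// mulr_gt0.
  have := hL u v wu wv.
  have := enorm_triangle u (- v); rewrite enormN (omega_enorm wu) (omega_enorm wv) => uv.
  have := ler_wpM2l (ltW L0) uv.
  move: (_ * dot e v) (L * enorm _) => a b *; lra.
pose t := inf S.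
have lbS : lbound S 0 by move=> s [].
have tle v : omega v -> dot x v + t * dot e v <= h v.
  move=> wv; rewrite -lerBrDl -ler_ndivrMr ?eneg//; apply: lb_le_inf => // s [_ hs].
  by rewrite ler_ndivrMr ?eneg// lerBrDl; exact: hs.
have t0 : 0 < t.
  have := tle u wu; rewrite -lerBrDl => h1.
  have : t * dot e u < 0 by lra.
  by rewrite nmulr_llt0 ?eneg.
have CK : C (x + t *: e).
  by apply: coneD; [exact: interior_subset|apply: coneZ => //; exact: ltW].
have Kt : K (x + t *: e).
  by apply: (pc_det hK) => // v wv; rewrite dotDl dotZl; exact: tle.
have [v wv tight] : exists2 v, omega v & dot x v + t * dot e v = h v.
  apply: contrapT => nt.
  have strict v : omega v -> dot x v + t * dot e v < h v.
    move=> wv; rewrite lt_neqAle tle// andbT; apply/eqP => tight; apply: nt; by exists v.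
  have [||r r0 hr] := @compact_uniform R _ omega
    (fun r v => dot x v + t * dot e v + r <= h v) omega_compact.
  - by move=> r s v _ sr; apply: le_trans; rewrite lerD2l.
  - move=> v0 wv0.
    (* The slack at [v] varies by at most |x + t e| + L times the distance to [v0]; the extra 1
       leaves a margin [g / M]. *)
    pose M := enorm (x + t *: e) + L + 1.
    have M0 : 0 < M by rewrite ltr_wpDl// addr_ge0 ?enorm_ge0// ltW.
    pose g := h v0 - (dot x v0 + t * dot e v0).
    have g0 : 0 < g by rewrite subr_gt0 strict.
    exists (g / M) => [|v wv vv0]; first exact: divr_gt0.
    have := dot_le (x + t *: e) (v - v0); rewrite dotBr !dotDl !dotZl.
    have := hL v0 v wv0 wv; rewrite enormB_sym.
    have := ler_wpM2l (enorm_ge0 (x + t *: e)) (ltW vv0).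
    have := ler_wpM2l (ltW L0) (ltW vv0).
    have : (enorm (x + t *: e) + L + 1) * (g / M) = g by rewrite mulrC divfK// gt_eqF.
    move: (g / M) (enorm (v - v0)) (enorm _) => q D a.
    rewrite !mulrDl mul1r /g.
    move: (a * q) (L * q) (a * D) (L * D) (t * dot e v) (t * dot e v0) => *; lra.
  (* Keeps [t - d] nonnegative and costs at most the margin [r]. *)
  pose d := Num.min t (r / enorm e).
  have d0 : 0 < d by rewrite lt_min t0 divr_gt0.
  have : S (t - d).
    split; first by rewrite subr_ge0 ge_min lexx.
    move=> v wv; have := hr v wv.
    have := dot_ge e v; rewrite (omega_enorm wv) mulr1.
    have : d * enorm e <= r by rewrite -ler_pdivlMr// ge_min lexx orbT.
    have := ltW d0; move: (dot e v) (enorm e) (dot x v) (h v) => *; nra.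
  move=> /(ge_inf (ex_intro _ 0 lbS)); rewrite -/t; lra.
exists t, v => //; split.
  split => //; first by apply: int_coneD => //; apply: coneZ => //; exact: ltW.
  by exists v => //; rewrite dotDl dotZl.
rewrite -tight gtrDl pmulr_rlt0//; exact: eneg.
Qed.

End cone.

(** * Additivity in the set of normals *)

(* The translates of F by [t *: d], [0 <= t <= 1], are pairwise separated and
   remain in a bounded set. *)
Lemma hausN_null_of_translates (R : realType) (m : nat) (F : set 'rV[R]_m) (d : 'rV[R]_m)
    (c b : R) : 0 < c ->
  (forall x y, F x -> F y -> supn (x - y) <= b) ->
  (forall x y t, F x -> F y -> `|t| <= c * supn (x - y - t *: d)) ->
  hausN (@supn R m) m F = 0%E.
Proof.
move=> c0 Fb Fsep.
have s0 := @supn_ge0 R m.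
set V := hausN _ _.
have [->|/set0P[x0 Fx0]] := eqVneq F set0; first exact: hausN0.
have b0 : 0 <= b by apply: le_trans (Fb x0 x0 Fx0 Fx0).
pose T (k j : nat) := [set y : 'rV[R]_m | exists2 i : nat, (i < j)%N &
   exists2 x, F x & y = x + (i%:R / k.+1%:R) *: d].
have sum k j : (j%:R%:E * V F <= V (T k j))%E.
  elim: j => [|j ih]; first by rewrite mul0e hausN_ge0.
  rewrite -natr1 EFinD ge0_muleDl ?lee_fin ?ler0n// mul1e.
  apply: (@le_trans _ _ (V (T k j) + V ((fun x => x + (j%:R / k.+1%:R) *: d)%R @` F))%E).
    by apply: leeD => //; exact: hausN_supn_translate.
  apply: (@le_trans _ _ (V (T k j `|` (fun x => x + (j%:R / k.+1%:R) *: d)%R @` F))).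
    apply: (@hausN_sep _ _ _ _ s0 _ _ ((k.+1%:R * c)^-1)).
      by rewrite invr_gt0 mulr_gt0.
    move=> _ _ [i ij [x Fx ->]] [y Fy <-].
    have := Fsep x y ((j%:R - i%:R) / k.+1%:R) Fx Fy.
    rewrite (_ : x - y - _ = x + (i%:R / k.+1%:R) *: d - (y + (j%:R / k.+1%:R) *: d)); last first.
      by rewrite mulrBl scalerBl opprB [in RHS]opprD addrACA.
    rewrite -ler_pdivrMl//.
    apply: le_trans; rewrite invfM mulrC ler_wpM2l ?invr_ge0 ?(ltW c0)//.
    rewrite normrM normfV (ger0_norm (ler0n _ _)) ger0_norm; last first.
      by rewrite subr_ge0 ler_nat ltnW.
    by rewrite ler_peMl ?invr_ge0 ?ler0n// -natrB ?(ltnW ij)// ler1n subn_gt0.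
  apply: hausN_mono => // _ [[i ij [x Fx ->]]|[x Fx <-]].
    by exists i; [exact: ltnW|exists x].
  by exists j => //; exists x.
pose B := b + 2 * supn d.
have B0 : 0 <= B by rewrite addr_ge0 ?mulr_ge0.
have bound k : ((k.+1)%:R%:E * V F <= (B ^+ m * haus_ratio (@supn R m))%:E)%E.
  apply: (le_trans (sum k k.+1)); apply: hausN_sub_cube => //; first exact: supn_norm.
  move=> _ _ [i ik [x Fx ->]] [j jk [y Fy ->]].
  have frac (l : nat) : (l < k.+1)%N -> supn ((l%:R / k.+1%:R) *: d) <= supn d.
    move=> lk; rewrite /supn normrZ ler_piMl// ger0_norm ?divr_ge0 ?ler0n//.
    by rewrite ler_pdivrMr// mul1r ler_nat ltnW.
  rewrite opprD addrACA; apply: (le_trans (ler_normD _ _)); apply: lerD; first exact: Fb.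
  apply: (le_trans (ler_normB _ _)); rewrite [2 * _]mulr_natl mulr2n.
  by apply: lerD; exact: frac.
have VF : V F \is a fin_num.
  rewrite ge0_fin_numE ?hausN_ge0//.
  exact: hausN_supn_bounded Fb.
apply/eqP; rewrite eq_le hausN_ge0// andbT -(fineK VF) lee_fin leNgt; apply/negP => VF0.
have := bound (Num.truncn (B ^+ m * haus_ratio (@supn R m) / fine (V F))).
rewrite -(fineK VF) -EFinM lee_fin leNgt => /negP; apply.
by rewrite -ltr_pdivrMr// truncnS_gt.
Qed.

Lemma null_caratheodory (R : realType) (T : Type) (mu : {outer_measure set T -> \bar R})
  (B : set T) : mu B = 0%E -> mu.-caratheodory B.
Proof.
move=> B0; apply: le_caratheodory_measurable => X.
have -> : mu (X `&` B) = 0%E.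
  apply/eqP; rewrite eq_le outer_measure_ge0 andbT -B0.
  by apply: le_outer_measure; exact: subIsetr.
by rewrite add0e; apply: le_outer_measure; exact: subIsetl.
Qed.

Section contact_measure.
Context (R : realType) (m : nat).
Local Notation E := 'rV[R]_m.+1.
Local Notation H := (hausN (@enorm R m.+1) m).
Local Notation V := (hausN (@supn R m) m).
Variables (C omega : set E).
Hypothesis hC : pointed_closed_convex_cone C.
Hypothesis omega_compact : compact omega.
Hypothesis omegaC : omega `<=` Omega C.
Variables (e : E) (P : E -> 'rV[R]_m) (J : 'rV[R]_m -> E).
Hypotheses (Ce : C e) (e0 : e != 0) (hP : projection_along e P J).
Variables (K : set E) (h : E -> R).
Hypothesis hK : pseudocone C omega K h.

Local Notation T := (contact C K h).

Lemma contact_sub A B : A `<=` B -> T A `<=` T B.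
Proof. by move=> AB x [Cx Kx [u Au xu]]; split => //; exists u => //; exact: AB. Qed.

Lemma contactU A B : T (A `|` B) = T A `|` T B.
Proof.
apply/seteqP; split => x; last by move=> [|]; apply: contact_sub => y; [left|right].
by move=> [Cx Kx [u [Au|Bu] xu]]; [left|right]; split => //; exists u.
Qed.

Lemma contact_bigcup (A : nat -> set E) : T (\bigcup_i A i) = \bigcup_i T (A i).
Proof.
apply/seteqP; split => x.
  by move=> [Cx Kx [u [i _ Au] xu]]; exists i => //; split => //; exists u.
by move=> [i _]; apply: contact_sub => u Au; exists i.
Qed.

Lemma dot_axis_lt0 u : omega u -> dot e u < 0.
Proof.
move=> wu; have [c c0 hc] := cone_strict omega_compact omegaC.
by apply: (le_lt_trans (hc u e wu Ce)); rewrite oppr_lt0 mulr_gt0// enorm_gt0.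
Qed.

(** A contact point [x] has [dot x u = h u], bounded below through a fixed point of [K], while
    [cone_strict] makes this product at most -c|x|. *)
Lemma contact_bounded : exists2 b, 0 < b & forall x, T omega x -> enorm x <= b.
Proof.
have [c c0 hc] := cone_strict omega_compact omegaC.
have [[y Ky]|K0] := pselect (K !=set0); last first.
  by exists 1 => // x [_ Kx _]; exfalso; apply: K0; exists x.
exists (enorm y / c + 1); first by rewrite ltr_wpDl// divr_ge0 ?enorm_ge0// ltW.
move=> x [_ Kx [u wu xu]]; rewrite ler_wpDr// ler_pdivlMr// mulrC.
have := hc u x wu (pc_sub hK Kx); rewrite xu.
have := pc_le hK wu Ky; have := dot_ge y u; rewrite (omega_enorm omegaC wu) mulr1; lra.
Qed.

(** The contact set is a Lipschitz graph over its projection: supporting at [x] and at [y] bounds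
    the component of [x - y] along [e] from either side, because [e] makes a definite angle with all
    of [omega]. *)
Lemma contact_bilip : exists2 k, 0 < k &
  forall x y, T omega x -> T omega y -> enorm (x - y) <= k * supn (P x - P y).
Proof.
have [c c0 hc] := cone_strict omega_compact omegaC.
have [d d0 hd] := sec_bound hP.
have ee := enorm_gt0 e0.
exists (d * (1 + c^-1)); first by rewrite mulr_gt0// addr_gt0// invr_gt0.
move=> x y [_ Kx [u wu xu]] [_ Ky [v wv yv]].
rewrite -(prjB hP); have [s zE] := proj_dec hP (x - y).
set q := J _ in zE.
have qd : enorm q <= d * supn (P (x - y)) by exact: hd.
have xu' : 0 <= dot (x - y) u by rewrite dotBl subr_ge0 xu; exact: (pc_le hK).
have yv' : dot (x - y) v <= 0 by rewrite dotBl subr_le0 yv; exact: (pc_le hK).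
have su : c * enorm e * s <= enorm q.
  have := dot_le q u; rewrite (omega_enorm omegaC wu) mulr1.
  have := hc u e wu Ce; move: xu'; rewrite zE dotDl dotZl.
  have [s0|s0] := ltP s 0.
    move=> *; apply: (@le_trans _ _ 0); last exact: enorm_ge0.
    by rewrite nmulr_lle0 // mulr_ge0 ?ltW.
  move: (enorm q) (dot q u) (dot e u) (c * _) => *; nra.
have sv : - (c * enorm e * s) <= enorm q.
  have := dot_ge q v; rewrite (omega_enorm omegaC wv) mulr1.
  have := hc v e wv Ce; move: yv'; rewrite zE dotDl dotZl.
  have [s0|s0] := ltP 0 s.
    move=> *; apply: (@le_trans _ _ 0); last exact: enorm_ge0.
    by rewrite oppr_le0 !mulr_ge0 ?ltW.
  move: (enorm q) (dot q v) (dot e v) (c * _) => *; nra.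
have se : `|s| * enorm e <= c^-1 * enorm q.
  rewrite ler_pdivlMl// mulrCA -[X in X <= _](_ : `|c * enorm e * s| = _).
    by rewrite ler_norml su andbT lerNl.
  rewrite !normrM gtr0_norm// (gtr0_norm ee); ring.
rewrite [X in enorm X]zE; apply: (le_trans (enorm_triangle _ _)); rewrite enormZ.
rewrite mulrAC mulrDr mulr1; apply: lerD => //.
by apply: (le_trans se); rewrite mulrC ler_wpM2r// invr_ge0 ltW.
Qed.

(** The product of [x - y] with the normal at [x] is nonnegative and that with the normal at [y] is
    nonpositive; both normals are close to [u0]. *)
Lemma contact_flat (u0 : E) (rho : R) (eta : set E) : eta `<=` omega ->
  (forall u, eta u -> enorm (u - u0) <= rho) -> flat u0 rho (T eta).
Proof.
move=> etaw near x y [_ Kx [u eu xu]] [_ Ky [v ev yv]].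
have xu' : 0 <= dot (x - y) u by rewrite dotBl subr_ge0 xu; apply: (pc_le hK) => //; exact: etaw.
have yv' : dot (x - y) v <= 0 by rewrite dotBl subr_le0 yv; apply: (pc_le hK) => //; exact: etaw.
have z0 := enorm_ge0 (x - y).
have := dot_le (x - y) (u - u0); have := dot_ge (x - y) (v - u0); rewrite !dotBr.
have := ler_wpM2l z0 (near u eu); have := ler_wpM2l z0 (near v ev).
rewrite ler_norml [rho * _]mulrC; move: (enorm (x - y) * _) (enorm (x - y) * _) (enorm (x - y) * _) => *.
by apply/andP; split; lra.
Qed.

Definition two_normals (r : R) (A B : set E) : set E :=
  [set x | exists u v, [/\ A u, B v, r <= enorm (u - v), T [set u] x & T [set v] x]].

Let W A := V (P @` A).

Lemma proj_mono A B : A `<=` B -> (W A <= W B)%E.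
Proof. by move=> AB; apply: hausN_mono; exact: image_subset. Qed.

Lemma proj_bigcup0 (A : nat -> set E) : (forall i, W (A i) = 0%E) -> W (\bigcup_i A i) = 0%E.
Proof.
move=> A0; apply/eqP; rewrite eq_le hausN_ge0 ?andbT; last exact: supn_ge0.
rewrite /W image_bigcup.
apply: (le_trans (hausN_sigma_subadditive m (@supn_ge0 R m) (fun i => P @` A i))).
by rewrite eseries0// => i _ _; exact: A0.
Qed.

Lemma projU0 A B : W A = 0%E -> W B = 0%E -> W (A `|` B) = 0%E.
Proof.
move=> A0 B0; rewrite -bigcup2E; apply: proj_bigcup0 => -[|[|i]] //=.
by rewrite /W image_set0 hausN0//; exact: supn_ge0.
Qed.

Lemma proj_sub0 A B : A `<=` B -> W B = 0%E -> W A = 0%E.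
Proof.
move=> AB B0; apply/eqP; rewrite eq_le hausN_ge0 ?andbT; last exact: supn_ge0.
by rewrite -[X in (_ <= X)%E]B0; exact: proj_mono.
Qed.

(* Take w in the span of u0 and v0 orthogonal to e: the set is almost orthogonal to
   w, so that its projection has separated translates along the projection of w. *)
Lemma two_normals_local_null (u0 v0 : E) : omega u0 -> omega v0 -> u0 <> v0 ->
  exists2 rho : R, 0 < rho & forall r,
   W (two_normals r (omega `&` [set u | enorm (u - u0) < rho])
               (omega `&` [set v | enorm (v - v0) < rho])) = 0%E.
Proof.
move=> wu0 wv0 uv.
have eu := dot_axis_lt0 wu0; have ev := dot_axis_lt0 wv0.
pose w : E := dot e v0 *: u0 - dot e u0 *: v0.
have we : dot e w = 0 by rewrite dotBr !dotZr mulrC subrr.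
have w0 : w != 0.
  apply/eqP => /subr0_eq w0; apply: uv.
  have /(congr1 (@enorm R _)) := w0.
  rewrite !enormZ (omega_enorm omegaC wu0) (omega_enorm omegaC wv0) !mulr1.
  rewrite !ltr0_norm// => /oppr_inj ee; move: w0; rewrite ee.
  by apply: scalerI; rewrite lt_eqF.
pose q := dot w w; have q0 : 0 < q by rewrite /q -sqr_enorm exprn_gt0// enorm_gt0.
(* As [w] is orthogonal to [e], the product with [w] factors through [P]. *)
pose l (y : 'rV[R]_m) := dot (J y) w.
have lP z : l (P z) = dot z w.
  by have [s zE] := proj_dec hP z; rewrite [in RHS]zE dotDl dotZl we mulr0 addr0.
have lB y z : l (y - z) = l y - l z by rewrite /l (secB hP) dotBl.
have lZ t y : l (t *: y) = t * l y by rewrite /l (secZ hP) dotZl.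
have [d d0 hd] := sec_bound hP.
pose c2 := d * enorm w.
have c20 : 0 <= c2 by rewrite mulr_ge0 ?enorm_ge0// ltW.
have lbound y : `|l y| <= c2 * supn y.
  apply: (le_trans (cauchy_schwarz _ _)); rewrite /c2 mulrAC.
  by rewrite ler_wpM2r ?enorm_ge0.
have [k k0 hk] := contact_bilip.
pose S := `|dot e v0| + `|dot e u0|.
have S0 : 0 < S by rewrite ltr_wpDl// normr_gt0 lt_eqF.
pose D := P w; have D0 := supn_ge0 D.
(* Small enough for the term in |t| caused by non-orthogonality to be absorbed by half of |t| q. *)
pose rho := q / 2 / (S * k * (supn D + 1)).
have rho0 : 0 < rho.
  by rewrite !divr_gt0// !mulr_gt0// ltr_wpDl.
have rhoE : S * rho * k * supn D + S * rho * k = q / 2.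
  rewrite -[X in _ + X]mulr1 -mulrDr /rho; field.
  by rewrite !gt_eqF// ltr_wpDl.
exists rho => // r.
set X := two_normals _ _ _.
have XT : X `<=` T omega.
  by move=> x [u [v [[wu _] _ _ Tu _]]]; apply: contact_sub Tu => _ ->.
have Xflat x y : X x -> X y -> `|dot (x - y) w| <= S * rho * enorm (x - y).
  have etaw z : omega `&` [set u | enorm (u - z) < rho] `<=` omega by move=> u [].
  have near (z : E) u : (omega `&` [set u | enorm (u - z) < rho]) u -> enorm (u - z) <= rho.
    by move=> [_ /ltW].
  move=> [u [v [au bv _ Tu Tv]]] [u' [v' [au' bv' _ Tu' Tv']]].
  have f1 : `|dot (x - y) u0| <= rho * enorm (x - y).
    apply: (contact_flat (etaw u0) (@near u0)).
      by apply: contact_sub Tu => _ ->.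
    by apply: contact_sub Tu' => _ ->.
  have f2 : `|dot (x - y) v0| <= rho * enorm (x - y).
    apply: (contact_flat (etaw v0) (@near v0)).
      by apply: contact_sub Tv => _ ->.
    by apply: contact_sub Tv' => _ ->.
  rewrite dotBr !dotZr; apply: (le_trans (ler_normB _ _)); rewrite !normrM.
  rewrite /S -mulrA mulrDl; apply: lerD; exact: ler_wpM2l.
have [b b0 hb] := contact_bounded.
have [cP cP0 hcP] := proj_bound hP.
apply: (@hausN_null_of_translates R m _ D ((q / 2 + c2 + S * rho * k) / (q / 2)) (cP * (2 * b))).
- have q2 : 0 < q / 2 by exact: divr_gt0.
  apply: divr_gt0 => //; apply: ltr_wpDl; last exact: mulr_gt0 (mulr_gt0 S0 rho0) k0.
  exact: addr_ge0 (ltW q2) c20.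
- move=> _ _ [x Xx <-] [y Xy <-]; rewrite -(prjB hP); apply: (le_trans (hcP _)).
  rewrite ler_pM2l//; apply: (le_trans (enorm_triangle _ _)); rewrite enormN mulr_natl mulr2n.
  by apply: lerD; apply: hb; exact: XT.
move=> _ _ t [x Xx <-] [y Xy <-].
rewrite mulrAC ler_pdivlMr ?divr_gt0//.
set eta := supn _.
have eta0 : 0 <= eta by exact: supn_ge0.
have h1 : supn (P x - P y) <= eta + `|t| * supn D.
  have -> : P x - P y = (P x - P y - t *: D) + t *: D by rewrite subrK.
  apply: (le_trans (ler_normD _ _)); rewrite lerD2l /supn normrZ; exact: lexx.
have h2 : `|t| * q <= S * rho * (k * (eta + `|t| * supn D)) + c2 * eta.
  have -> : `|t| * q = `|l (P x - P y) - l (P x - P y - t *: D)|.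
    by rewrite -lB opprB addrC subrK lZ lP normrM (gtr0_norm q0).
  apply: (le_trans (ler_normB _ _)); apply: lerD => //.
  rewrite -(prjB hP) lP; apply: (le_trans (Xflat _ _ Xx Xy)).
  apply: ler_wpM2l; first exact: mulr_ge0 (ltW S0) (ltW rho0).
  apply: (le_trans (hk _ _ (XT _ Xx) (XT _ Xy))).
  by rewrite ler_pM2l.
have : `|t| * (q / 2) + (`|t| * (S * rho * k)) <= (c2 + S * rho * k) * eta.
  have : `|t| * (S * rho * k * supn D + S * rho * k) = `|t| * (q / 2) by rewrite rhoE.
  move: h2; move: (S * rho) (supn D) (`|t|) => a b' c h2 h3.
  have -> : c * (q / 2) = c * q - c * (q / 2) by field.
  rewrite -h3; lra.
move=> h3; apply: (@le_trans _ _ ((c2 + S * rho * k) * eta)).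
  by apply: le_trans h3; rewrite lerDl mulr_ge0// ltW// mulr_gt0// mulr_gt0.
by rewrite ler_wpM2r// lerD2r lerDr ltW// divr_gt0.
Qed.

(** [compact_ideal] is applied in each of the two normals. Around a pair of distinct normals the
    local lemma applies; around a diagonal pair, radius [r / 2] leaves no pair at distance [r]. *)
Lemma two_normals_null (r : R) : 0 < r -> W (two_normals r omega omega) = 0%E.
Proof.
move=> r0.
have sub A A' B B' : A `<=` A' -> B `<=` B' -> two_normals r A B `<=` two_normals r A' B'.
  by move=> AA BB x [u [v [Au Bv ? ? ?]]]; exists u, v; split => //; [exact: AA|exact: BB].
have UL A A' B : two_normals r (A `|` A') B `<=` two_normals r A B `|` two_normals r A' B.
  by move=> x [u [v [[Au|Au] Bv ? ? ?]]]; [left|right]; exists u, v; split.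
have UR A B B' : two_normals r A (B `|` B') `<=` two_normals r A B `|` two_normals r A B'.
  by move=> x [u [v [Au [Bv|Bv] ? ? ?]]]; [left|right]; exists u, v; split.
have W0 : W set0 = 0%E by rewrite /W image_set0 hausN0//; exact: supn_ge0.
apply: (compact_ideal (I := fun A => W (two_normals r A omega) = 0%E) omega_compact).
- by apply: proj_sub0 W0 => x [u [v []]].
- by move=> B B' BB'; apply: proj_sub0; exact: sub.
- by move=> B B' B0 B0'; apply: (proj_sub0 (UL _ _ _)); exact: projU0.
move=> u0 wu0.
suff [rho rho0 hrho] : exists2 rho : R, 0 < rho &
    W (two_normals r (omega `&` [set u | enorm (u - u0) < rho]) omega) = 0%E.
  exists [set u | enorm (u - u0) < rho]; first by apply/nbhs_enorm; exists rho.
  by rewrite setIC.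
apply: (compact_ideal (I := fun A => exists2 rho : R, 0 < rho &
    W (two_normals r (omega `&` [set u | enorm (u - u0) < rho]) A) = 0%E) omega_compact).
- by exists 1 => //; apply: proj_sub0 W0 => x [u [v []]].
- by move=> B B' BB' [rho rho0 h0]; exists rho => //; apply: proj_sub0 h0; exact: sub.
- move=> B B' [rho rho0 h0] [rho' rho0' h0']; exists (Num.min rho rho').
    by rewrite lt_min rho0.
  apply: (proj_sub0 (UR _ _ _)); apply: projU0.
    apply: proj_sub0 h0; apply: sub => // u [wu /= lt]; split => //=.
    by apply: lt_le_trans lt _; rewrite ge_min lexx.
  apply: proj_sub0 h0'; apply: sub => // u [wu /= lt]; split => //=.
  by apply: lt_le_trans lt _; rewrite ge_min lexx orbT.
move=> v0 wv0; have [uv|/eqP uv] := eqVneq u0 v0; last first.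
  have [rho rho0 h0] := two_normals_local_null wu0 wv0 uv.
  exists [set v | enorm (v - v0) < rho]; first by apply/nbhs_enorm; exists rho.
  by exists rho => //; rewrite [X in two_normals _ _ X]setIC.
exists [set v | enorm (v - v0) < r / 2].
  by apply/nbhs_enorm; exists (r / 2) => //; exact: divr_gt0.
exists (r / 2); first exact: divr_gt0.
apply: proj_sub0 W0 => x [u [v [[_ /= uu] [/= vv _] ruv _ _]]].
move: ruv; rewrite leNgt => /negP; apply.
rewrite -(subrKA u0) (_ : u0 - v = v0 - v) ?uv//.
apply: (le_lt_trans (enorm_triangle _ _)); rewrite (enormB_sym v0).
by rewrite [ltRHS]splitr; apply: ltrD => //; rewrite -uv.
Qed.

Definition multi_normal : set E := \bigcup_(i : nat) two_normals (i.+1%:R^-1) omega omega.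

Lemma proj_multi : W multi_normal = 0%E.
Proof. by apply: proj_bigcup0 => i; apply: two_normals_null; rewrite invr_gt0. Qed.

Lemma contactI_multi_normal A B : A `<=` omega -> B `<=` omega -> A `&` B = set0 ->
  T A `&` T B `<=` multi_normal.
Proof.
move=> Aw Bw AB x [[Cx Kx [u Au xu]] [_ _ [v Bv xv]]].
have uv : 0 < enorm (u - v).
  apply: enorm_gt0; rewrite subr_eq0; apply/eqP => uv.
  by have : (A `&` B) u; [split; rewrite // uv|rewrite AB].
exists (Num.truncn (enorm (u - v))^-1) => //; exists u, v; split.
- exact: Aw.
- exact: Bw.
- by rewrite invf_ple ?posrE// ltW// truncnS_gt.
- by split => //; exists u.
- by split => //; exists v.
Qed.

Lemma multi_normal_sub : multi_normal `<=` T omega.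
Proof. by move=> x [i _ [u [v [wu _ _ Tu _]]]]; apply: contact_sub Tu => _ ->. Qed.

Lemma hausN_le_proj : exists2 k, 0 < k & forall A, A `<=` T omega -> (H A <= k%:E * W A)%E.
Proof.
have [k k0 hk] := contact_bilip.
exists (k ^+ m) => [|A AT]; first exact: exprn_gt0.
apply: hausN_preimage => //; [by move=> x; exact: enorm_ge0|by move=> x; exact: supn_ge0|].
by move=> x y Ax Ay; apply: hk; exact: AT.
Qed.

Lemma hausN_multi : H multi_normal = 0%E.
Proof.
have [k k0 hk] := hausN_le_proj.
apply/eqP; rewrite eq_le hausN_ge0 ?andbT; last by move=> x; exact: enorm_ge0.
by apply: (le_trans (hk _ multi_normal_sub)); rewrite proj_multi mule0.
Qed.

(** Leaving out the interior of [C] makes the set closed; the contact set is its intersection with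
    an open set, hence measurable for every metric outer measure. *)
Lemma contact_closed (F : set E) : closed F ->
  closed [set x | K x /\ exists2 u, (omega `&` F) u & dot x u = h u].
Proof.
move=> clF; apply/closed_enorm => x nx.
have [Kx|nKx] := pselect (K x); last first.
  have [r r0 hr] := (closed_enorm K).1 (pc_closed hK) x nKx.
  by exists r => // y [Ky _]; exact: hr.
have [L L0 hL] := pc_lip hK.
have [||r r0 hr] := @compact_uniform R _ omega
  (fun r u => F u -> forall y, enorm (x - y) < r -> dot y u < h u) omega_compact.
- by move=> r s v _ sr hr Fv y ys; apply: hr => //; exact: lt_le_trans sr.
- move=> u wu; have [Fu|nFu] := pselect (F u); last first.
    have [r r0 hr] := (closed_enorm F).1 clF u nFu; exists r => // v wv vr Fv.
    by have := hr v Fv; rewrite enormB_sym leNgt vr.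
  pose g := h u - dot x u.
  have g0 : 0 < g.
    rewrite subr_gt0 lt_neqAle (pc_le hK)// andbT; apply/eqP => xu; apply: nx.
    by split => //; exists u.
  pose M := enorm x + L + 1.
  have M0 : 0 < M by rewrite ltr_wpDl// addr_ge0 ?enorm_ge0// ltW.
  exists (g / M) => [|v wv vu _ y xy]; first exact: divr_gt0.
  have := hL u v wu wv; rewrite enormB_sym.
  have := dot_le x (v - u); rewrite dotBr.
  have := dot_ge (x - y) v; rewrite (omega_enorm omegaC wv) mulr1 dotBl.
  have := ler_wpM2l (enorm_ge0 x) (ltW vu).
  have := ler_wpM2l (ltW L0) (ltW vu).
  have : (enorm x + L + 1) * (g / M) = g by rewrite mulrC divfK// gt_eqF.
  move: xy; move: (g / M) (enorm (v - u)) (enorm (x - y)) (enorm x) => q D d a.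
  rewrite !mulrDl mul1r /g.
  move: (a * q) (L * q) (a * D) (L * D) => *; lra.
exists r => // y [Ky [u [wu Fu] yu]]; rewrite leNgt; apply/negP => xy.
by have := hr u wu Fu y xy; rewrite yu ltxx.
Qed.

Section metric_measure.
Variable mu : {outer_measure set E -> \bar R}.
Hypothesis mu_metric : metric_om (@enorm R m.+1) mu.
Hypothesis mu_multi : mu multi_normal = 0%E.

Let closed_cara (F : set E) : closed F -> mu.-caratheodory F.
Proof.
move=> /closed_enorm clF.
exact: (metric_caratheodory (@enorm_triangle R m.+1) mu_metric clF).
Qed.

Let contact_closed_cara (F : set E) : closed F -> mu.-caratheodory (T (omega `&` F)).
Proof.
move=> clF.
have -> : T (omega `&` F) = C° `&` [set x | K x /\ exists2 u, (omega `&` F) u & dot x u = h u].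
  by apply/seteqP; split => x; [move=> [? ? ?]|move=> [? [? ?]]].
apply: caratheodory_measurable_setI; last exact/closed_cara/contact_closed.
rewrite -(setCK C°); apply: caratheodory_measurable_setC; apply: closed_cara.
by rewrite closedC; exact: open_interior.
Qed.

(** The good sets of normals contain the closed ones and are stable under countable unions.
    Complements are the delicate point, as [T] does not respect them; the discrepancy consists of
    points with two normals, which are null. *)
Lemma contact_caratheodory (eta : set (borelRn R m.+1)) : measurable eta ->
  mu.-caratheodory (T (omega `&` eta)).
Proof.
have TC (eta' : set E) : mu.-caratheodory (T (omega `&` eta')) ->
    mu.-caratheodory (T (omega `&` ~` eta')).
  move=> c1.
  have -> : T (omega `&` ~` eta') = (T omega `\` T (omega `&` eta')) `|`
      (T (omega `&` ~` eta') `&` T (omega `&` eta')).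
    have TE : T omega = T (omega `&` eta') `|` T (omega `&` ~` eta').
      by rewrite -contactU -setIUr setUCr setIT.
    rewrite TE; apply/seteqP; split => x; last by move=> [[[]//]|[]].
    move=> Tx; have [Tx'|Tx'] := pselect (T (omega `&` eta') x); first by right.
    by left; split => //; right.
  apply: caratheodory_measurable_setU.
    apply: caratheodory_measurable_setD => //.
    by rewrite -[X in T X]setIT; apply: contact_closed_cara; exact: closedT.
  apply: null_caratheodory; apply/eqP; rewrite eq_le outer_measure_ge0 andbT -mu_multi.
  apply: le_outer_measure; apply: contactI_multi_normal; try exact: subIsetl.
  by rewrite setIACA setICl setI0.
suff : <<s @open E>> `<=` [set eta' | mu.-caratheodory (T (omega `&` eta'))] by exact.
apply: smallest_sub; last first.
  move=> O oO; rewrite /= -(setCK O); apply: TC; apply: contact_closed_cara.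
  by rewrite closedC.
split.
- have T0 : T set0 = set0 by apply/seteqP; split => x // [_ _ []].
  by rewrite /= setI0 T0; exact: caratheodory_measurable_set0.
- by move=> A cA; rewrite /= setTD; exact: TC.
- move=> A cA; rewrite /= setI_bigcupr contact_bigcup.
  exact: caratheodory_measurable_bigcup.
Qed.

Lemma contact_superadditive (eta1 eta2 : set (borelRn R m.+1)) : measurable eta1 ->
  eta1 `<=` omega -> eta2 `<=` omega -> eta1 `&` eta2 = set0 ->
  (mu (T eta1) + mu (T eta2) <= mu (T (eta1 `|` eta2)))%E.
Proof.
move=> m1 w1 w2 d12; have := contact_caratheodory m1.
rewrite (setIidr w1) => c1; rewrite (c1 (T (eta1 `|` eta2))); apply: leeD.
  by apply: le_outer_measure => x Tx; split => //; rewrite contactU; left.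
apply: (@le_trans _ _ (mu ((T eta2 `\` T eta1) `|` multi_normal))).
  apply: le_outer_measure => x T2; have [T1|T1] := pselect (T eta1 x); last by left.
  by right; apply: (contactI_multi_normal w1 w2 d12).
apply: (le_trans (outer_measureU2 _ _ _)); rewrite mu_multi adde0.
by apply: le_outer_measure => x [T2 T1]; split => //; rewrite contactU; right.
Qed.

End metric_measure.

(** The restriction to [T omega], where [P] has a Lipschitz inverse, makes this a metric outer
    measure on E, so that the results above apply to projected area as well as to Hausdorff
    measure. *)
Definition projected (A : set E) := V (P @` (A `&` T omega)).

Let projected0 : projected set0 = 0%E.
Proof. by rewrite /projected set0I image_set0 hausN0//; exact: supn_ge0. Qed.

Let projected_ge0 A : (0 <= projected A)%E.
Proof. by apply: hausN_ge0; exact: supn_ge0. Qed.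

Let projected_mono : {homo projected : A B / A `<=` B >-> (A <= B)%E}.
Proof. by move=> A B AB; apply: hausN_mono; apply: image_subset; exact: setSI. Qed.

Let projected_sigma : sigma_subadditive projected.
Proof.
move=> A; rewrite /projected setI_bigcupl image_bigcup.
apply: (hausN_sigma_subadditive m (@supn_ge0 R m) (fun i => P @` (A i `&` T omega))).
Qed.

Definition projected_om : {outer_measure set E -> \bar R} := HB.pack projected
  (isOuterMeasure.Build R E projected projected0 projected_ge0 projected_mono projected_sigma).

Lemma projected_metric : metric_om (@enorm R m.+1) projected_om.
Proof.
move=> A B r r0 AB; have [k k0 hk] := contact_bilip.
rewrite /= /projected setIUl image_setU.
apply: (hausN_sep m (@supn_ge0 R m) (_ : 0 < k^-1 * r)).
  by rewrite mulr_gt0// invr_gt0.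
move=> _ _ [x [Ax Tx] <-] [y [By Ty] <-].
by rewrite ler_pdivrMl//; apply: le_trans (hk _ _ Tx Ty); exact: AB.
Qed.

Lemma projected_multi : projected_om multi_normal = 0%E.
Proof. by rewrite /= /projected (setIidl multi_normal_sub); exact: proj_multi. Qed.

End contact_measure.

(** * Integrals with respect to superadditive set functions *)

(* [surface_area C A] is not a measure on all Borel sets, so that the lemmas of the
   library on integrals do not apply to it. *)
Section integral_bounds.
Context d (T : measurableType d) (R : realType).
Variables (mu : set T -> \bar R) (D : set T).
Hypotheses (mD : measurable D) (mu0 : mu set0 = 0%E) (mu_ge0 : forall A, (0 <= mu A)%E).
Hypothesis mu_mono : {homo mu : A B / A `<=` B >-> (A <= B)%E}.
Hypothesis mu_super : forall A B, measurable A -> measurable B -> A `<=` D ->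
  B `<=` D -> A `&` B = set0 -> (mu A + mu B <= mu (A `|` B))%E.
Variable f : T -> R.
Hypothesis f_ge0 : forall x, D x -> 0 <= f x.

Import HBNNSimple.

Let nnint (g : T -> \bar R) := ereal_sup [set sintegral mu h |
  h in [set h : {nnsfun T >-> R} | forall x, ((h x)%:E <= g x)%E]].

Let nnint0 : nnint (cst 0%E) = 0%E.
Proof.
have s0 (h : {nnsfun T >-> R}) : (forall x, ((h x)%:E <= 0)%E) -> sintegral mu h = 0%E.
  move=> h0; rewrite /sintegral fsbig1// => r _.
  have [->|r0] := eqVneq r 0; first by rewrite mul0e.
  rewrite (_ : h @^-1` [set r] = set0) ?mu0 ?mule0//.
  apply/seteqP; split => x //= hr; move/eqP: r0; apply; rewrite -hr.
  by apply/eqP; rewrite eq_le -lee_fin h0/=.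
apply/eqP; rewrite eq_le; apply/andP; split.
  by apply: ge_ereal_sup => _ [h h0 <-]; rewrite s0.
by apply: ereal_sup_ubound; exists nnsfun0 => //; exact: s0.
Qed.

Let integral_nnint : (\int[mu]_(x in D) (f x)%:E)%E = nnint ((EFin \o f) \_ D).
Proof.
have f0 x : (0 <= ((EFin \o f) \_ D) x)%E.
  by rewrite patchE; case: ifPn => // /[!inE] Dx; rewrite lee_fin f_ge0.
rewrite /integral -/(nnint _) -/(nnint _).
rewrite [X in (_ - nnint X)%E](_ : _ = cst 0%E); last first.
  by apply/funext => x; rewrite funenegE max_r// leeNl oppe0.
rewrite nnint0 sube0; congr nnint; apply/funext => x.
by rewrite funeposE max_l.
Qed.

Lemma super_integral_ge (a : R) : 0 <= a -> (forall x, D x -> a <= f x) ->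
  (a%:E * mu D <= \int[mu]_(x in D) (f x)%:E)%E.
Proof.
rewrite le_eqVlt => /predU1P[<- _|a0 af].
  rewrite mul0e integral_nnint; apply: ereal_sup_ubound.
  exists nnsfun0; last first.
    rewrite /sintegral fsbig1// => r _; have [->|r0] := eqVneq r 0; first by rewrite mul0e.
    rewrite (_ : _ @^-1` [set r] = set0) ?mu0 ?mule0//.
    by apply/seteqP; split => x //= hr; move/eqP: r0; apply; rewrite -hr.
  by move=> x; rewrite patchE; case: ifPn => // /[!inE] Dx; rewrite lee_fin f_ge0.
rewrite integral_nnint.
have [h hE] : exists h : {nnsfun T >-> R}, forall x, h x = if x \in D then a else 0.
  exists (scale_nnsfun (indic_nnsfun R mD) (ltW a0)) => x.
  rewrite /scale_nnsfun /= /mindic indicE.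
  by case: (x \in D); rewrite ?mulr1 ?mulr0.
have -> : (a%:E * mu D)%E = sintegral mu h.
  rewrite /sintegral -(fsbig_widen [set a])//.
    rewrite fsbig_set1; congr (_ * mu _)%E; apply/seteqP; split => x /=.
      by move=> Dx; rewrite hE mem_set.
    by rewrite hE; case: ifPn => [/[!inE]//|_ a0']; move: a0; rewrite -a0' ltxx.
  move=> r [_ /= /eqP ra]; have [->|r0] := eqVneq r 0; first by rewrite mul0e.
  rewrite (_ : _ @^-1` [set r] = set0) ?mu0 ?mule0//.
  apply/seteqP; split => x //=; rewrite hE; case: ifPn => _ hr.
    by move: ra; rewrite hr eqxx.
  by move: r0; rewrite -hr eqxx.
apply: ereal_sup_ubound; exists h => // x; rewrite hE patchE.
by case: ifPn => // /[!inE] Dx; rewrite lee_fin af.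
Qed.

(** For a simple function below the integrand, the fibers of its positive values are disjoint
    subsets of [D]; adding them one at a time, superadditivity bounds the sum by [b] times the
    measure of their union. *)
Lemma super_integral_le (b : R) : (forall x, D x -> f x <= b) ->
  (\int[mu]_(x in D) (f x)%:E <= b%:E * mu D)%E.
Proof.
move=> fb; have [->|/set0P[x0 Dx0]] := eqVneq D set0.
  rewrite mu0 mule0 /integral patch_set0 -/(nnint _) -/(nnint _).
  rewrite (_ : funepos _ = cst 0%E); last by apply/funext => x; rewrite funeposE maxxx.
  rewrite (_ : funeneg _ = cst 0%E); last by apply/funext => x; rewrite funenegE oppe0 maxxx.
  by rewrite nnint0 sube0.
have b0 : 0 <= b by apply: le_trans (fb _ Dx0); exact: f_ge0.
rewrite integral_nnint; apply: ge_ereal_sup => _ [h hf <-].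
have mh r : measurable (h @^-1` [set r]) by exact: measurable_sfunP.
have hD x : 0 < h x -> D x /\ h x <= b.
  move=> hx; have := hf x; rewrite patchE; case: ifPn => [/[!inE] Dx|_].
    by rewrite lee_fin => /le_trans; split => //; rewrite (le_trans _ (fb x Dx))// -lee_fin; have := hf x; rewrite patchE mem_set.
  by rewrite lee_fin leNgt hx.
have hsub r : 0 < r -> h @^-1` [set r] `<=` D.
  by move=> r0 x /= hr; have [] : D x /\ h x <= b by apply: hD; rewrite hr.
have claim (s : seq R) : uniq s -> all (fun r => 0 < r) s ->
    (\sum_(r <- s) r%:E * mu (h @^-1` [set r]) <=
      b%:E * mu (h @^-1` [set` s]))%E /\ measurable (h @^-1` [set` s]) /\ h @^-1` [set` s] `<=` D.
  elim: s => [_ _|r s ih].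
    rewrite big_nil (_ : _ @^-1` _ = set0); last by apply/seteqP; split.
    by rewrite mu0 mule0; split => //; split.
  move=> /= /andP[rs us] /andP[r0 s0].
  have [ih1 [ih2 ih3]] := ih us s0.
  have -> : h @^-1` [set` r :: s] = h @^-1` [set r] `|` h @^-1` [set` s].
    apply/seteqP; split => x /=; first by rewrite inE => /orP[/eqP|]; [left|right].
    by rewrite inE => -[->|->]; rewrite ?eqxx ?orbT.
  split; last first.
    split; first exact: measurableU.
    by rewrite subUset; split => //; exact: hsub.
  rewrite big_cons; apply: (@le_trans _ _ (b%:E * (mu (h @^-1` [set r]) + mu (h @^-1` [set` s])))%E).
    rewrite ge0_muleDr//; apply: leeD => //.
    have [->|/set0P[x hx]] := eqVneq (h @^-1` [set r]) set0; first by rewrite mu0 !mule0.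
    apply: lee_wpmul2r => //; rewrite lee_fin -hx.
    by have [] : D x /\ h x <= b by apply: hD; rewrite hx.
  apply: lee_wpmul2l; first by rewrite lee_fin.
  apply: mu_super => //; first exact: hsub.
  apply/seteqP; split => x //= [-> xs]; by move: rs; rewrite xs.
pose A : set R := range h `&` [set r | 0 < r].
have finA : finite_set A by apply: sub_finite_set (fimfunP h) => r [].
have -> : sintegral mu h = (\sum_(r <- finmap.enum_fset (fset_set A)) r%:E * mu (h @^-1` [set r]))%E.
  rewrite /sintegral; apply: fsbigTE => r; rewrite in_fset_set// notin_setE => nA.
  have [->|r0] := eqVneq r 0; first by rewrite mul0e.
  rewrite (_ : h @^-1` [set r] = set0) ?mu0 ?mule0//.
  apply/seteqP; split => x //= hr; apply: nA; split; first by exists x.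
  by rewrite /= lt_neqAle eq_sym r0 -hr; exact: (@fun_ge0 _ _ h).
have [] := claim (finmap.enum_fset (fset_set A)).
- exact: finmap.fset_uniq.
- by apply/allP => r; rewrite in_fset_set// inE => -[].
move=> h1 [_ h2]; apply: (le_trans h1); apply: lee_wpmul2l; first by rewrite lee_fin.
exact: mu_mono.
Qed.

End integral_bounds.

(** * The normalizing constant of Hausdorff measure *)

Section surface.
Context (R : realType) (m : nat).

Definition kappa : R := fine (volume (@unit_ball R m)) * 2 ^- m.

Lemma volume_ball_gt0 : (0 < volume (@unit_ball R m))%E.
Proof.
apply: (@lt_le_trans _ _ ((m.+1%:R^-1 : R) ^+ m)%:E).
  by rewrite lte_fin exprn_gt0// invr_gt0.
apply: volume_cube_ge; first by rewrite invr_ge0.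
move=> x hx; apply: (le_trans (enorm_le_supn x)).
rewrite -ler_pdivlMl// mulr1; apply/(supn_le x); first by rewrite invr_ge0.
by move=> i; have /andP[x0 x1] := hx i; rewrite ger0_norm.
Qed.

Lemma volume_ball_fin : volume (@unit_ball R m) \is a fin_num.
Proof.
rewrite ge0_fin_numE ?ltW ?volume_ball_gt0//.
apply: (@le_lt_trans _ _ ((\prod_(i < m) (1 - -1 : R))%:E)); last by rewrite ltry.
apply: ereal_inf_lbound; exists [set 0%N], (fun=> const_mx (-1)), (fun=> const_mx 1); split.
- by move=> k i; rewrite !mxE; lra.
- move=> x x1; exists 0%N => // i; rewrite !mxE -ler_norml.
  exact: le_trans (coord_le_supn _ _) (le_trans (supn_le_enorm _) x1).
- rewrite esum_set1; last by rewrite lee_fin prodr_ge0// => i _; rewrite !mxE; lra.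
  by congr EFin; apply: eq_bigr => i _; rewrite !mxE.
Qed.

Lemma kappa_gt0 : 0 < kappa.
Proof.
rewrite mulr_gt0 ?invr_gt0 ?exprn_gt0// -lte_fin fineK ?volume_ball_gt0//.
exact: volume_ball_fin.
Qed.

Lemma hausdorff_hausN (E : set 'rV[R]_m.+1) :
  hausdorff m E = (kappa%:E * hausN (@enorm R m.+1) m E)%E.
Proof. by rewrite /hausdorff /kappa EFinM fineK//; exact: volume_ball_fin. Qed.

End surface.

(** * The comparison argument *)

Section uniqueness.
Context (R : realType) (m : nat).
Local Notation E := 'rV[R]_m.+1.
Local Notation H := (hausN (@enorm R m.+1) m).
Local Notation V := (hausN (@supn R m) m).
Variables (C omega : set E).
Hypothesis hC : pointed_closed_convex_cone C.
Hypothesis omega_compact : compact omega.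
Hypothesis omegaC : omega `<=` Omega C.

Variables (e : E) (P : E -> 'rV[R]_m) (J : 'rV[R]_m -> E).
Hypotheses (Ce : C e) (e0 : e != 0) (hP : projection_along e P J).

Section one_set.
Variable A : set E.
Local Notation K := (C `\` A).
Local Notation h := (support_function (C `\` A)).
Hypothesis hK : pseudocone C omega K h.
Local Notation T := (contact C K h).
Local Notation W := (fun eta => V (P @` T eta)).

(** The two bounds are separate implications because the upper one will be applied to the first set
    and the lower one to the second. The superadditivity that they require holds since points with
    several normals are null. *)
Lemma Lp_surface_area_bounds (p a b : R) (eta : set (borelRn R m.+1)) :
  measurable eta -> eta `<=` omega ->
  (0 <= a -> (forall u, eta u -> a <= hbar C A u `^ (1 - p)) ->
   (a%:E * ((kappa R m)%:E * H (T eta)) <= Lp_surface_area C A p eta)%E) /\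
  ((forall u, eta u -> hbar C A u `^ (1 - p) <= b) ->
   (Lp_surface_area C A p eta <= b%:E * ((kappa R m)%:E * H (T eta)))%E).
Proof.
move=> meta eta_omega.
have n0 := @enorm_ge0 R m.+1.
have SE eta' : eta' `<=` omega -> surface_area C A eta' = ((kappa R m)%:E * H (T eta'))%E.
  by move=> sub; rewrite /surface_area (reverse_gauss_contact omegaC hK sub) hausdorff_hausN.
have S0 : surface_area C A set0 = 0%E.
  rewrite SE ?sub0set// (_ : T set0 = set0) ?hausN0 ?mule0//.
  by apply/seteqP; split => x // [_ _ []].
have Sge0 eta' : (0 <= surface_area C A eta')%E.
  rewrite /surface_area hausdorff_hausN mule_ge0 ?hausN_ge0// lee_fin ltW//.
  exact: kappa_gt0.
have Smono : {homo surface_area C A : B D / B `<=` D >-> (B <= D)%E}.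
  move=> B D BD; rewrite /surface_area !hausdorff_hausN; apply: lee_wpmul2l.
    by rewrite lee_fin ltW// kappa_gt0.
  by apply: hausN_mono => x [bx [u Bu ux]]; split => //; exists u => //; exact: BD.
have Ssuper (B D : set (borelRn R m.+1)) : measurable B -> measurable D -> B `<=` eta -> D `<=` eta ->
    B `&` D = set0 -> (surface_area C A B + surface_area C A D <= surface_area C A (B `|` D))%E.
  move=> mB mD Beta Deta BD.
  have Bw := subset_trans Beta eta_omega; have Dw := subset_trans Deta eta_omega.
  rewrite !SE//; last by rewrite subUset.
  rewrite -ge0_muleDr ?hausN_ge0//; apply: lee_wpmul2l.
    by rewrite lee_fin ltW// kappa_gt0.
  apply: (contact_superadditive (mu := hausN_om m n0) omega_compact omegaC hK _ _ mB Bw Dw BD).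
    exact: hausN_metric.
  exact: (hausN_multi omega_compact omegaC Ce e0 hP hK).
have f0 u : eta u -> 0 <= hbar C A u `^ (1 - p) by move=> _; exact: powR_ge0.
rewrite -SE//; split => [a0 af|fb].
  exact: super_integral_ge.
exact: super_integral_le.
Qed.

Lemma proj_contact_superadditive (B D : set (borelRn R m.+1)) : measurable B -> B `<=` omega ->
  D `<=` omega -> B `&` D = set0 -> (W B + W D <= W (B `|` D))%E.
Proof.
move=> mB Bw Dw BD.
have := contact_superadditive (mu := projected_om C omega P K h) omega_compact omegaC hK
  (projected_metric omega_compact omegaC Ce e0 hP hK)
  (projected_multi omega_compact omegaC Ce e0 hP hK) mB Bw Dw BD.
rewrite /= /projected !setIidl//; apply: contact_sub => //.
by rewrite subUset.
Qed.

Lemma proj_contact_subadditive (B D : set E) : (W (B `|` D) <= W B + W D)%E.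
Proof.
rewrite /= contactU image_setU.
exact: (outer_measureU2 (hausN_om m (@supn_ge0 R m))).
Qed.

Lemma proj_contact_fin B : B `<=` omega -> W B \is a fin_num.
Proof.
move=> Bw; rewrite ge0_fin_numE; last by apply: hausN_ge0; exact: supn_ge0.
have [b b0 hb] := contact_bounded omega_compact omegaC hK.
have [c c0 hc] := proj_bound hP.
apply: (@hausN_supn_bounded _ _ _ (c * (b + b))) => _ _ [x Tx <-] [y Ty <-].
rewrite -(prjB hP); apply: (le_trans (hc _)); rewrite ler_pM2l//.
apply: (le_trans (enorm_triangle _ _)); rewrite enormN.
by apply: lerD; apply: hb; [apply: contact_sub Tx|apply: contact_sub Ty].
Qed.

(** Continuity in multiplicative form: near [u0] the density is a constant up to the factor [s]. *)
Lemma powR_near (p s : R) (u0 : E) : 0 < p < 1 -> omega u0 -> 1 < s ->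
  exists2 a, 0 < a & exists2 rho, 0 < rho & forall u, omega u -> enorm (u - u0) < rho ->
    a <= hbar C A u `^ (1 - p) <= s * a.
Proof.
move=> /andP[p0 p1] wu0 s1.
(* [hbar] will stay between [y / r] and [y * r]; the quotient [r ^+ 2] is at most [s], also after
   taking the power [1 - p], which is at most 1. *)
have [r r1 rs] := exists_root_gt1 2 s1.
have r0 : 0 < r := lt_trans ltr01 r1.
have p10 : 0 <= 1 - p by rewrite subr_ge0 ltW.
pose y := hbar C A u0.
have y0 : 0 < y by rewrite oppr_gt0 (pc_neg hK).
have yr0 : 0 < y / r by exact: divr_gt0.
exists ((y / r) `^ (1 - p)); first exact: powR_gt0.
have [L L0 hL] := pc_lip hK.
have d0 : 0 < y * (1 - r^-1) by rewrite mulr_gt0// subr_gt0 invf_lt1.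
exists (y * (1 - r^-1) / L) => [|u wu uu0]; first exact: divr_gt0.
have Lu : L * enorm (u - u0) <= y * (1 - r^-1).
  by move: uu0; rewrite ltr_pdivlMr// mulrC => /ltW.
have yE : y = - h u0 by [].
have e1 : y * (1 - r^-1) = y - y / r by ring.
rewrite e1 in Lu.
have lo : y / r <= hbar C A u.
  have := hL u u0 wu wu0; move: Lu; rewrite /hbar yE.
  move: (- h u0 / r) (L * _) (h u) (h u0) => a b c d; lra.
have hi : hbar C A u <= r ^+ 2 * (y / r).
  have -> : r ^+ 2 * (y / r) = y * r by field; rewrite gt_eqF.
  have ry : 0 <= y * (r + r^-1 - 2).
    have rr : r * r^-1 = 1 by rewrite divff ?gt_eqF.
    apply: mulr_ge0; first exact: ltW.
    have : 0 < r^-1 by rewrite invr_gt0.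
    have := sqr_ge0 (r - 1).
    by move: (r^-1) rr => r' *; nra.
  have e2 : y * (r + r^-1 - 2) = y * r + y / r - 2 * y by ring.
  rewrite e2 in ry.
  have := hL u0 u wu0 wu; rewrite enormB_sym; move: Lu ry; rewrite /hbar yE.
  move: (- h u0 / r) (- h u0 * r) (L * _) (h u) (h u0) => a b c d f; lra.
have hu0 : 0 <= hbar C A u by rewrite (le_trans (ltW yr0)).
apply/andP; split; first by apply: ge0_ler_powR; rewrite ?nnegrE ?(ltW yr0).
apply: (@le_trans _ _ ((r ^+ 2 * (y / r)) `^ (1 - p))).
  by apply: ge0_ler_powR; rewrite ?nnegrE// mulr_ge0 ?exprn_ge0// ltW.
rewrite powRM ?exprn_ge0 ?(ltW r0) ?(ltW yr0)//.
apply: ler_wpM2r; first exact: powR_ge0.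
apply: le_trans rs; apply: ler1_powR; last by rewrite gerBl ltW.
by rewrite exprn_ege1// ltW.
Qed.

End one_set.

(** * Maximum principle for the projections *)

Section two_sets.
Variables A1 A2 : set E.
Local Notation K1 := (C `\` A1).
Local Notation h1 := (support_function (C `\` A1)).
Local Notation K2 := (C `\` A2).
Local Notation h2 := (support_function (C `\` A2)).
Hypothesis hK1 : pseudocone C omega K1 h1.
Hypothesis hK2 : pseudocone C omega K2 h2.
Local Notation T1 := (contact C K1 h1).
Local Notation T2 := (contact C K2 h2).
Local Notation W1 eta := (V (P @` T1 eta)).
Local Notation W2 eta := (V (P @` T2 eta)).

(* As hbar = - h, this is the set where hbar A2 > l * hbar A1. *)
Let U (l : R) : set E := [set u | omega u /\ h2 u < l * h1 u].

Let U_omega l : U l `<=` omega. Proof. by move=> u []. Qed.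

Let proj_e_shift x t : P (x + t *: e) = P x.
Proof. by rewrite -[t]opprK scaleNr (prjB hP) (prjZ hP) (proj_e hP) scaler0 subr0. Qed.

Lemma push_proj (l : R) (x u : E) : C° x -> omega u -> h2 u < dot x u ->
  (forall v, omega v -> dot x v <= l * h1 v) -> (P @` T2 (U l)) (P x).
Proof.
move=> Cx wu xu xl.
have [t [v wv [Tv hv]]] := push_contact hC omega_compact omegaC hK2 Ce e0 Cx wu xu.
exists (x + t *: e); last exact: proj_e_shift.
by apply: contact_sub Tv => _ ->; split => //; apply: lt_le_trans hv _; exact: xl.
Qed.

Lemma proj_contact_dilate (l : R) : 1 <= l -> (W1 (U l) <= W2 (U l))%E.
Proof.
move=> l1; have l0 : 0 < l := lt_le_trans ltr01 l1.
have V0 : (0 <= W1 (U l))%E by apply: hausN_ge0; exact: supn_ge0.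
apply: (@le_trans _ _ ((l ^+ m)%:E * W1 (U l))%E).
  by rewrite -[X in (X <= _)%E]mul1e; apply: lee_wpmul2r => //; rewrite lee_fin exprn_ege1.
apply: (le_trans (hausN_supn_dilate _ l0)); apply: hausN_mono.
move=> _ [_ [x [Cx Kx [u [wu hu] xu]] <-] <-]; rewrite -(prjZ hP).
apply: (push_proj (u := u)) => //.
- exact: int_coneZ.
- by rewrite dotZl xu.
- by move=> v wv; rewrite dotZl ler_pM2l//; exact: (pc_le hK1).
Qed.

(** A whole ball of points satisfies the assumptions of [push_proj]. Its centre is [l *: y], with
    [y] nearly attaining [h1 u], shifted by a small multiple of the interior point [z] of [C], which
    creates slack in all constraints without using up the gap at [u]. *)
Lemma proj_contact_gt0 (l : R) (z u : E) : 0 < l -> C° z -> U l u -> (0 < W2 (U l))%E.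
Proof.
move=> l0 Cz [wu hu].
have [c c0 hc] := cone_strict omega_compact omegaC.
(* If [z = 0], a neighbourhood of the origin lies in [C], and a negative multiple of [e] contradicts
   [cone_strict]. *)
have z0 : 0 < enorm z.
  apply: enorm_gt0; apply/eqP => z0; have [r r0 hr] := (nbhs_enorm _ _).1 Cz.
  have ee := enorm_gt0 e0.
  have : C (- (r / 2 / enorm e) *: e).
    apply: hr; rewrite z0 subr0 enormZ normrN ger0_norm ?divr_ge0 ?enorm_ge0 ?ltW//.
    by rewrite divfK ?gt_eqF// ltr_pdivrMr// ltr_pMr// ltr1n.
  move=> /(hc u _ wu); rewrite dotZl leNgt => /negP; apply.
  apply: (@le_lt_trans _ _ 0); first by rewrite oppr_le0 mulr_ge0 ?enorm_ge0// ltW.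
  rewrite nmulr_rgt0 ?oppr_lt0 ?divr_gt0//.
  exact: (dot_axis_lt0 omega_compact omegaC Ce e0 wu).
pose g := (l * h1 u - h2 u) / l.
have g0 : 0 < g by rewrite divr_gt0// subr_gt0.
have lg : l * g = l * h1 u - h2 u by rewrite mulrC divfK// gt_eqF.
have [y Ky hy] := pc_sup hK1 wu (divr_gt0 g0 (ltr0n _ 2)).
pose t := l * g / 4 / enorm z.
have t0 : 0 < t by rewrite !divr_gt0// mulr_gt0.
have tz : t * enorm z = l * g / 4 by rewrite divfK// gt_eqF.
pose x := t *: z + l *: y.
have Cx : C° x.
  apply: (int_coneD hC); first exact: (int_coneZ hC).
  by apply: (coneZ hC); [exact: (pc_sub hK1)|exact: ltW].
have [r r0 hr] := (nbhs_enorm _ _).1 (nbhs_interior Cx).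
(* Of the gap [l * g] at [u], the choice of [y] costs at most a half, the shift a quarter and the
   radius [s] an eighth. In the constraint for any [v] the shift gains at least
   [c * (l * g / 4)]. *)
pose s := Num.min (r / 2) (Num.min (c * (l * g / 4)) (l * g / 8)).
have lg4 : 0 < l * g / 4 by rewrite divr_gt0// mulr_gt0.
have s0 : 0 < s.
  rewrite !lt_min; apply/and3P; split; first exact: divr_gt0.
    exact: mulr_gt0.
  by rewrite divr_gt0// mulr_gt0.
have sr : s < r by rewrite gt_min ltr_pdivrMr// ltr_pMr ?ltr1n.
have sc : s <= c * (l * g / 4) by rewrite !ge_min lexx orbT.
have sl : s <= l * g / 8 by rewrite !ge_min lexx !orbT.
have good x' : enorm (x' - x) <= s -> (P @` T2 (U l)) (P x').
  move=> xx'.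
  have xE v : omega v -> `|dot x' v - (t * dot z v + l * dot y v)| <= s.
    move=> wv; rewrite -!dotZl -dotDl -dotBl; apply: (le_trans (cauchy_schwarz _ _)).
    by rewrite (omega_enorm omegaC wv) mulr1.
  apply: (push_proj (u := u)) => //.
  - by apply: hr; exact: le_lt_trans sr.
  - have := xE u wu; rewrite ler_norml => /andP[lo _].
    have := dot_ge z u; rewrite (omega_enorm omegaC wu) mulr1.
    move=> /(ler_wpM2l (ltW t0)); rewrite mulrN tz.
    have : l * (h1 u - g / 2) < l * dot y u by rewrite ltr_pM2l.
    rewrite mulrBr mulrA lg; move: lo sl lg.
    move: (t * _) (l * _) (l * h1 u) (l * g) => a b d f *; lra.
  - move=> v wv; have := xE v wv; rewrite ler_norml => /andP[_ hi].
    have := hc v z wv (interior_subset Cz).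
    move=> /(ler_wpM2l (ltW t0)); rewrite mulrN mulrCA tz.
    have : l * dot y v <= l * h1 v by rewrite ler_pM2l//; exact: (pc_le hK1).
    move: hi sc; move: (t * _) (l * _) (l * h1 v) (c * _) => a b d f *; lra.
have [d d0 hd] := sec_bound hP.
apply: (@hausN_supn_gt0 _ _ (P x) (s / d)); first exact: divr_gt0.
move=> y' hy'.
have -> : y' + P x = P (x + J y').
  rewrite -[J y']opprK (prjB hP) -[- J y']scaleN1r (prjZ hP) (prjK hP).
  by rewrite scaleN1r opprK addrC.
apply: good; rewrite addrAC subrr add0r; apply: (le_trans (hd _)).
by rewrite mulrC -ler_pdivlMr.
Qed.

(** * Comparison of projected areas from the equality of measures *)

Section comparison.
Variable p : R.
Hypothesis p01 : 0 < p < 1.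
Hypothesis measE : forall eta : set (borelRn R m.+1), measurable eta -> eta `<=` omega ->
  Lp_surface_area C A1 p eta = Lp_surface_area C A2 p eta.

(** Three errors of factor [k]: the flatness of each contact set and the variation of the first
    density. [kappa] and the ratio at [u0] stand on both sides and cancel. *)
Lemma proj_contact_compare_local (l k : R) (u0 : E) : 1 < l -> 1 < k -> omega u0 ->
  exists2 rho : R, 0 < rho & forall eta : set (borelRn R m.+1), measurable eta ->
    eta `<=` U l -> (forall u, eta u -> enorm (u - u0) < rho) ->
    ((l `^ (1 - p))%:E * W2 eta <= (k ^+ 3)%:E * W1 eta)%E.
Proof.
move=> l1 k1 wu0.
have eu0 : dot e u0 != 0 by rewrite lt_eqF// (dot_axis_lt0 omega_compact omegaC Ce e0 wu0).
have [theta theta0 flatP] := flat_compare hP e0 eu0 k1.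
have [a a0 [r r0 hr]] := powR_near hK1 p01 wu0 k1.
have [p0 p1] := andP p01.
set q := l `^ (1 - p).
have q0 : 0 < q by rewrite powR_gt0// (lt_trans ltr01).
exists (Num.min theta r); first by rewrite lt_min theta0.
move=> eta meta etaU near.
have etaw : eta `<=` omega by apply: subset_trans etaU _; exact: U_omega.
have near_theta u : eta u -> enorm (u - u0) <= theta.
  by move=> /near; rewrite lt_min => /andP[/ltW].
have near_r u : eta u -> enorm (u - u0) < r.
  by move=> /near; rewrite lt_min => /andP[].
have [f1 _] := flatP _ (contact_flat hK1 etaw near_theta).
have [g1 f2] := flatP _ (contact_flat hK2 etaw near_theta).
have := proj_contact_fin hK1 etaw; have := proj_contact_fin hK2 etaw => /=.
have [_ hi] := @Lp_surface_area_bounds A1 hK1 p 0 (k * a) eta meta etaw.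
have [lo _] := @Lp_surface_area_bounds A2 hK2 p (q * a) 0 eta meta etaw.
rewrite (measE meta etaw) in hi.
have {hi lo} : ((q * a)%:E * ((kappa R m)%:E * H (T2 eta)) <=
    (k * a)%:E * ((kappa R m)%:E * H (T1 eta)))%E.
  apply: le_trans (lo _ _) (hi _).
  - by rewrite mulr_ge0// ltW.
  - move=> u eu; have [wu hu] := etaU u eu.
    have /andP[ha _] := hr u wu (near_r u eu).
    apply: (@le_trans _ _ (q * hbar C A1 u `^ (1 - p))); first by rewrite ler_pM2l.
    have hb0 : 0 <= hbar C A1 u by rewrite oppr_ge0 ltW// (pc_neg hK1).
    have l0 : 0 <= l by rewrite ltW// (lt_trans ltr01).
    rewrite /q -powRM//; apply: ge0_ler_powR.
    + by rewrite subr_ge0 ltW.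
    + by rewrite nnegrE mulr_ge0.
    + by rewrite nnegrE oppr_ge0 ltW// (pc_neg hK2).
    + by rewrite /hbar mulrN lerN2 ltW.
  - by move=> u eu; have /andP[] := hr u (etaw _ eu) (near_r u eu).
move: f1 g1 f2; have := @sect_ratio_gt0 _ _ _ _ _ hP u0; have := kappa_gt0 R m.
have H10 : (0 <= H (T1 eta))%E by apply: hausN_ge0; exact: enorm_ge0.
have H20 : (0 <= H (T2 eta))%E by apply: hausN_ge0; exact: enorm_ge0.
move: H10 H20; move: (H (T1 eta)) (H (T2 eta)) (W1 eta) (W2 eta) => x1 x2 w1 w2.
move: (kappa R m) (sect_ratio _ _ _) => kap c x10 x20 kap0 c0 f1 g1 f2 lohi w2f w1f.
(* Flatness transfers finiteness from the projections to the Hausdorff measures, so the rest takes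
   place in the reals. *)
have x1f : x1 \is a fin_num.
  by rewrite ge0_fin_numE// (le_lt_trans f1)// -(fineK w1f) -!EFinM ltry.
have x2f : x2 \is a fin_num.
  by rewrite ge0_fin_numE// (le_lt_trans g1)// -(fineK w2f) -!EFinM ltry.
move: f1 f2 lohi; rewrite -(fineK x1f) -(fineK x2f) -(fineK w1f) -(fineK w2f).
rewrite -!EFinM !lee_fin.
move: (fine w1) (fine w2) (fine x1) (fine x2) => v1 v2 y1 y2 f1 f2 lohi.
have k0 : 0 < k := lt_trans ltr01 k1.
have {lohi} lohi : q * y2 <= k * y1.
  rewrite -(ler_pM2l (mulr_gt0 a0 kap0)).
  by rewrite [leLHS](_ : _ = q * a * (kap * y2)) ?[leRHS](_ : _ = k * a * (kap * y1))//; ring.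
rewrite -(ler_pM2l c0).
apply: (@le_trans _ _ (q * (k * y2))); first by rewrite mulrCA ler_pM2l.
rewrite mulrCA; apply: (@le_trans _ _ (k * (k * y1))); first by rewrite ler_pM2l.
apply: (@le_trans _ _ (k * (k * (k * (c * v1))))); first by rewrite !ler_pM2l.
by rewrite le_eqVlt; apply/orP; left; apply/eqP; ring.
Qed.

(** By continuity of both support functions the set is relatively open in [omega]. *)
Lemma dominated_measurable (l : R) : 0 < l -> measurable (U l : set (borelRn R m.+1)).
Proof.
move=> l0.
have open_meas (O : set E) : open O -> measurable (O : set (borelRn R m.+1)).
  by move=> oO; exact: sub_sigma_algebra.
have -> : U l = omega `&` (U l `|` ~` omega)°.
  apply/seteqP; split => [u Uu|u [wu /interior_subset[//|/(_ wu)//]]].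
  have [wu hu] := Uu; split => //; apply/nbhs_enorm.
  have [L1 L10 hL1] := pc_lip hK1; have [L2 L20 hL2] := pc_lip hK2.
  pose g := l * h1 u - h2 u; have g0 : 0 < g by rewrite subr_gt0.
  have M0 : 0 < L2 + l * L1 by rewrite addr_gt0// mulr_gt0.
  exists (g / (L2 + l * L1)) => [|v]; first exact: divr_gt0.
  rewrite ltr_pdivlMr// => vg; have [wv|] := pselect (omega v); last by right.
  left; split => //; have := hL2 v u wv wu.
  have := ler_wpM2l (ltW l0) (hL1 u v wu wv); rewrite enormB_sym mulrDr.
  move: vg; rewrite /g mulrDr mulrCA (mulrC _ L2) (mulrC _ L1).
  move: (L2 * _) (l * h1 u) (l * h1 v) (l * (L1 * _)) => a b c d *; lra.
apply: measurableI; last by apply: open_meas; exact: open_interior.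
rewrite -(setCK omega); apply: measurableC; apply: open_meas.
by rewrite openC; apply: compact_closed => //; exact: norm_hausdorff.
Qed.

Lemma proj_contact_compare (l k : R) : 1 < l -> 1 < k ->
  ((l `^ (1 - p))%:E * W2 (U l) <= (k ^+ 3)%:E * W1 (U l))%E.
Proof.
move=> l1 k1; set q := l `^ (1 - p).
have q0 : 0 <= q by exact: powR_ge0.
have k0 : 0 <= k ^+ 3 by rewrite exprn_ge0// ltW// (lt_trans ltr01).
have V0 (X : set 'rV[R]_m) : (0 <= V X)%E by apply: hausN_ge0; exact: supn_ge0.
(* Quantifying over all Borel subsets of a Borel [B'] makes the property pass to unions: [eta] is
   cut by [B'], with superadditivity for the first set and subadditivity for the second. *)
pose I (B : set E) := exists B' : set (borelRn R m.+1), [/\ measurable B', B `<=` B' &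
  forall eta : set (borelRn R m.+1), measurable eta -> eta `<=` U l -> eta `<=` B' ->
    (q%:E * W2 eta <= (k ^+ 3)%:E * W1 eta)%E].
suff [B' [_ wB' hB']] : I omega.
  apply: hB'; [apply: dominated_measurable; exact: lt_trans l1|by []|].
  by apply: subset_trans wB'; exact: U_omega.
apply: compact_ideal omega_compact _ _ _ _.
- exists (set0 : set (borelRn R m.+1)); split => //.
  move=> eta _ _; rewrite subset0 => ->.
  have -> : T2 set0 = set0 by apply/seteqP; split => x // [_ _ []].
  by rewrite image_set0 (hausN0 m (@supn_ge0 R m)) mule0 mule_ge0.
- by move=> B D BD [B' [mB' DB' h]]; exists B'; split => //; exact: subset_trans DB'.
- move=> B D [B' [mB' BB' hB]] [D' [mD' DD' hD]].
  exists (B' `|` D'); split; first exact: measurableU.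
    exact: setUSS.
  move=> eta meta etaU etaBD.
  have mI : measurable (eta `&` B') by exact: measurableI.
  have mD : measurable (eta `\` B') by exact: measurableD.
  have etaE : eta = (eta `&` B') `|` (eta `\` B') by rewrite setUIDK.
  have IU : eta `&` B' `<=` U l by move=> u [/etaU].
  have DU : eta `\` B' `<=` U l by move=> u [/etaU].
  have := @proj_contact_superadditive A1 hK1 _ _ mI (subset_trans IU (@U_omega _))
    (subset_trans DU (@U_omega _)).
  rewrite /= setDE setIACA setICr setI0 -setDE -etaE => /(_ erefl) sup.
  have := proj_contact_subadditive A2 (eta `&` B') (eta `\` B'); rewrite /= -etaE => sub.
  apply: (@le_trans _ _ (q%:E * (W2 (eta `&` B') + W2 (eta `\` B')))%E).
    by apply: lee_wpmul2l.
  apply: (@le_trans _ _ ((k ^+ 3)%:E * (W1 (eta `&` B') + W1 (eta `\` B')))%E); last first.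
    by apply: lee_wpmul2l.
  rewrite !ge0_muleDr//; apply: leeD.
    by apply: hB => //; exact: subIsetr.
  by apply: hD => // u [/etaBD[]].
- move=> u0 wu0; have [rho rho0 h] := proj_contact_compare_local l1 k1 wu0.
  have nb : nbhs u0 [set v | enorm (v - u0) < rho] by apply/nbhs_enorm; exists rho.
  exists ([set v | enorm (v - u0) < rho]°); first exact: nbhs_interior.
  exists ([set v | enorm (v - u0) < rho]°); split.
  + by apply: sub_sigma_algebra; exact: open_interior.
  + exact: subIsetl.
  + by move=> eta meta etaU etab; apply: h => // u /etab/interior_subset.
Qed.

Lemma support_function_le (u : E) : C° !=set0 -> omega u -> h1 u <= h2 u.
Proof.
move=> [z Cz] wu; rewrite leNgt; apply/negP => h21.
have h10 := pc_neg hK1 wu.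
(* Makes [l * h1 u] the midpoint of [h1 u] and [h2 u]; both being negative, [l] exceeds 1. *)
pose l := (1 + h2 u / h1 u) / 2.
have r1 : 1 < h2 u / h1 u by rewrite ltr_ndivlMr// mul1r.
have l1 : 1 < l by rewrite /l ltr_pdivlMr// mul1r [X in X < _](_ : _ = 1 + 1)// ltrD2l.
have l0 : 0 < l := lt_trans ltr01 l1.
have Uu : U l u.
  split => //; have -> : l * h1 u = (h1 u + h2 u) / 2 by rewrite /l; field; rewrite lt_eqF.
  rewrite ltr_pdivlMr//; lra.
have [p0 p1] := andP p01.
pose q := l `^ (1 - p).
have q1 : 1 < q.
  have p10 : 0 < 1 - p by rewrite subr_gt0.
  have := gt0_ltr_powR p10 (ler01 : 1 \is Num.nneg) (ltW l0 : l \is Num.nneg) l1.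
  by rewrite powR1.
have s1 : 1 < Num.sqrt q by rewrite -[X in X < _]sqrtr1 ltr_sqrt// (lt_trans ltr01).
have sq : Num.sqrt q < q.
  rewrite -[ltRHS]sqr_sqrtr ?(ltW (lt_trans ltr01 q1))// expr2 ltr_pMl//.
  exact: lt_trans s1.
(* Now [k ^+ 3] is strictly below [q], so the two comparisons contradict each other on a positive
   finite [W2]. *)
have [k k1 kq] := exists_root_gt1 3 s1.
have W20 := proj_contact_gt0 l0 Cz Uu.
have W2f := @proj_contact_fin A2 hK2 _ (@U_omega l).
have W12 := proj_contact_dilate (ltW l1).
have := proj_contact_compare l1 k1; rewrite -/q => cmp.
have : (q%:E * W2 (U l) <= (k ^+ 3)%:E * W2 (U l))%E.
  apply: (le_trans cmp); apply: lee_wpmul2l => //.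
  by rewrite lee_fin exprn_ge0// ltW// (lt_trans ltr01).
rewrite lee_pmul2r//= lee_fin leNgt => /negP; apply.
exact: le_lt_trans kq sq.
Qed.

End comparison.
End two_sets.
End uniqueness.

Theorem theorem5p3 (R : realType) (n : nat) (C omega : set 'rV[R]_n)
    (hC : pointed_closed_convex_cone C) (hC_int : C° !=set0)
    (homega0 : omega !=set0) (homega : compact omega)
    (homegaC : omega `<=` Omega C)
    (A1 A2 : set 'rV[R]_n)
    (hA1 : coconvex C A1) (hA2 : coconvex C A2)
    (hA1_0 : A1 !=set0) (hA2_0 : A2 !=set0)
    (hA1_omega : determined C omega (C `\` A1))
    (hA2_omega : determined C omega (C `\` A2))
    (p : R) (hp : 0 < p < 1)
    (hmeas : forall eta : set (borelRn R n), measurable eta -> eta `<=` omega ->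
       Lp_surface_area C A1 p eta = Lp_surface_area C A2 p eta) :
  A1 = A2.
Proof.
have [u0 wu0] := homega0.
(* In dimension 0 every norm is 0, so [omega] could not contain a unit vector. *)
case: n => [|m] in C omega hC hC_int homega0 homega homegaC A1 A2 hA1 hA2 hA1_0 hA2_0
  hA1_omega hA2_omega hmeas u0 wu0 *.
  have [+ _] := homegaC _ wu0.
  by rewrite /unit_sphere /= /enorm /dot big_ord0 sqrtr0 => /eqP; rewrite eq_sym oner_eq0.
have neq A : coconvex C A -> A !=set0 -> C `\` A <> C.
  by move=> [sAC _ _ _] [x Ax] CA; have : (C `\` A) x; [rewrite CA; exact: sAC|case].
have pc A : coconvex C A -> A !=set0 -> determined C omega (C `\` A) ->
    pseudocone C omega (C `\` A) (support_function (C `\` A)).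
  by move=> cA A0 dA; apply: determined_pseudocone => //; exact: neq.
have hK1 := pc _ hA1 hA1_0 hA1_omega; have hK2 := pc _ hA2 hA2_0 hA2_omega.
(* Any point of the first set serves as projection axis: it is nonzero because the support function
   is negative at [u0]. *)
have [e Ke _] := pc_sup hK1 wu0 ltr01.
have e0 : e != 0.
  apply/eqP => e0; have := pc_le hK1 wu0 Ke.
  by rewrite e0 dot0l leNgt (pc_neg hK1).
have [P [J hP]] := exists_projection e0.
have Ce : C e := pc_sub hK1 Ke.
have h12 u : omega u -> support_function (C `\` A1) u = support_function (C `\` A2) u.
  move=> wu; apply/eqP; rewrite eq_le; apply/andP; split.
    exact: (support_function_le hC homega homegaC Ce e0 hP hK1 hK2 hp hmeas).
  apply: (support_function_le hC homega homegaC Ce e0 hP hK2 hK1 hp) => // eta meta etaw.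
  by rewrite hmeas.
have K12 : C `\` A1 = C `\` A2.
  apply/seteqP; split => x Kx.
    apply: (pc_det hK2); first exact: (pc_sub hK1).
    by move=> u wu; rewrite -h12//; exact: (pc_le hK1).
  apply: (pc_det hK1); first exact: (pc_sub hK2).
  by move=> u wu; rewrite h12//; exact: (pc_le hK2).
have AE A : coconvex C A -> A = C `\` (C `\` A).
  by move=> [sAC _ _ _]; rewrite setDD; apply/esym/setIidPr.
by rewrite (AE _ hA1) (AE _ hA2) K12.
Qed.
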